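(* The bialgebras $(\mathcal{H}_{\mathbf{qp}},m,\Delta)$ and $(\mathcal{H}_{\mathbf{qp}},m,\delta)$ are in cointeraction via the coaction $\delta$. Moreover, give $A=\mathcal{H}_{\mathbf{qp}}$ the grading $A_n=Vect(\lfloor P\rfloor\in\mathbf{qp}\mid cl(P)=n)$, $n\geq0$. Then: 1. $(A,m,\Delta)$ is a graded connected Hopf algebra, and there is a graded subspace $V$ of $A$ such that, as a graded algebra, $A$ is isomorphic to the symmetric algebra $S(V)$ (generated by $V$). 2. $(A,m,\delta)$ is a bialgebra. 3. $(A,m,\Delta)$ and $(A,m,\delta)$ are in cointeraction through the coaction $\delta$. 4. $V_1=A_1$ has a basis $(g_i)_{i\in I}$ such that $\delta(g_i)=g_i\otimes g_i$ for all $i\in I$. (Denote by $J$ the set of finitely supported sequences $\alpha=(\alpha_i)_{i\in I}$ of non-negative integers and put $g_\alpha=\prod_{i\in I}g_i^{\alpha_i}$.) 5. For all $n\geq2$, $V_n$ can be decomposed as $V_n=\bigoplus_{i\in I,\alpha\in J}V_n(g_i,g_\alpha)$, such that for all $x\in V_n(g_i,g_\alpha)$: $$\delta(x)-g_i\otimes x-x\otimes g_\alpha\in S(V_1\oplus\cdots\oplus V_{n-1})^{\otimes2}.$$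
   Context: $\mathbb{K}$ is a field of characteristic zero. A quasi-poset is a pair $P=(A,\leq_P)$ with $A$ finite and $\leq_P$ reflexive and transitive; $x\sim_Py$ means $x\leq_Py$ and $y\leq_Px$; $cl(P)$ is the number of $\sim_P$-classes; $\lfloor P\rfloor$ is the isoclass; $P_{\mid B}$ is the restriction to $B\subseteq A$; $top(P)$ is the topology of open sets, i.e. subsets $O$ with ($i\in O$, $i\leq_Pj$)$\Rightarrow j\in O$; $P$ is connected if this topology is connected. $P$ is discrete if $\leq_P$ equals $\sim_P$. For an equivalence $\sim$ on $A$: $x\leq_{P|\sim}y$ iff $x\leq_Py$ and $x\sim y$; $\leq_{P/\sim}$ is the transitive closure of the relation ($x\leq_Py$ or $x\sim y$); these give quasi-posets $P|\sim$ and $P/\sim$ on $A$. We write $\sim\triangleleft P$ if the restriction of $P$ to each class of $\sim$ is connected and $\sim_{P/\sim}$ equals $\sim$. $\mathcal{H}_{\mathbf{qp}}$ is the $\mathbb{K}$-vector space with basis the set $\mathbf{qp}$ of isoclasses of quasi-posets, with product $m$ given by disjoint union (unit: empty quasi-poset), and coproducts $\Delta(\lfloor P\rfloor)=\sum_{O\in top(P)}\lfloor P_{\mid A\setminus O}\rfloor\otimes\lfloor P_{\mid O}\rfloor$ (counit: $1$ on the empty quasi-poset, $0$ on others) and $\delta(\lfloor P\rfloor)=\sum_{\sim\triangleleft P}\lfloor P/\sim\rfloor\otimes\lfloor P|\sim\rfloor$ (counit $\varepsilon'$: $1$ on discrete quasi-posets, $0$ on others). Cointeraction: two bialgebras $A$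 and $B$ are in cointeraction via $\rho:A\to A\otimes B$ if $\rho$ is a right coaction of $B$ on $A$ (i.e. $(\rho\otimes Id)\circ\rho=(Id\otimes\Delta_B)\circ\rho$ and $(Id\otimes\varepsilon_B)\circ\rho=Id$) and: (i) $\rho(1_A)=1_A\otimes1_B$; (ii) $m^3_{2,4}\circ(\rho\otimes\rho)\circ\Delta_A=(\Delta_A\otimes Id)\circ\rho$, where $m^3_{2,4}(a_1\otimes b_1\otimes a_2\otimes b_2)=a_1\otimes a_2\otimes b_1b_2$; (iii) $\rho(ab)=\rho(a)\rho(b)$ for all $a,b\in A$; (iv) $(\varepsilon_A\otimes Id)\circ\rho(a)=\varepsilon_A(a)1_B$ for all $a\in A$. A graded algebra $A$ is connected if $A_0=\mathbb{K}1$; $V_n=V\cap A_n$; $S(W)$ for $W\subseteq V$ denotes the subalgebra of $A$ generated by $W$. *)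

(* Defs.v *)
From HB Require Import structures.
From mathcomp Require Import all_boot all_order all_algebra.
From mathcomp Require Import generic_quotient ring_quotient.
From mathcomp Require Import finmap boolp.
From mathcomp Require Import monalg.

Set Implicit Arguments.
Unset Strict Implicit.
Unset Printing Implicit Defensive.

Import GRing.Theory.
Local Open Scope ring_scope.
Local Open Scope quotient_scope.

Section QuasiPoset.
Variable T : finType.

Definition is_qposet (r : {ffun T * T -> bool}) : bool :=
  [forall x, r (x, x)] &&
  [forall x, forall y, forall z, r (x, y) && r (y, z) ==> r (x, z)].

Record qposet := QPoset { qle : {ffun T * T -> bool}; _ : is_qposet qle }.

HB.instance Definition _ := [isSub for qle].
HB.instance Definition _ := [Finite of qposet by <:].

Definition qrel (P : qposet) : rel T := fun x y => qle P (x, y).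

Coercion qrel : qposet >-> rel.

Lemma qrefl (P : qposet) : reflexive P.
Proof. by have /andP[/forallP h _] := valP P; move=> x; apply: h. Qed.

Lemma qtrans (P : qposet) : transitive P.
Proof.
have /andP[_ /forallP h] := valP P; move=> y x z xy yz.
by move: (h x) => /forallP/(_ y)/forallP/(_ z)/implyP; apply; apply/andP.
Qed.

Lemma qposet_ofP (r : rel T) : reflexive r -> transitive r ->
  is_qposet [ffun p => r p.1 p.2].
Proof.
move=> rr tr; apply/andP; split; first by apply/forallP=> x; rewrite ffunE.
apply/forallP=> x; apply/forallP=> y; apply/forallP=> z; rewrite !ffunE /=.
by apply/implyP=> /andP[]; apply: tr.
Qed.

Definition qposet_of (r : rel T) (rr : reflexive r) (tr : transitive r) :
  qposet := QPoset (qposet_ofP rr tr).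

Lemma qposet_ofE r (rr : reflexive r) (tr : transitive r) x y :
  qposet_of rr tr x y = r x y.
Proof. by rewrite /qrel /= ffunE. Qed.

Lemma qposetP (P Q : qposet) : (forall x y, P x y = Q x y) -> P = Q.
Proof. by move=> h; apply/val_inj/ffunP=> -[x y]; apply: h. Qed.

Definition qsim (P : qposet) : rel T := fun x y => P x y && P y x.

Definition cl (P : qposet) : nat := #|[set [set y | qsim P x y] | x : T]|.

Definition qdiscrete (P : qposet) : bool :=
  [forall x, forall y, P x y == qsim P x y].

Definition qtop (P : qposet) : {set {set T}} :=
  [set O : {set T} | [forall i, forall j, (i \in O) && P i j ==> (j \in O)]].

(* The empty quasi-poset is connected with this convention; [triangle] only
   uses connectedness on nonempty classes. *)
Definition qconnected (P : qposet) : bool :=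
  [forall O : {set T},
     (O \in qtop P) && (~: O \in qtop P) ==> (O == set0) || (O == setT)].

(* An equivalence on T is encoded as a symmetric quasi-poset on T. *)
Definition is_equiv (E : qposet) : bool :=
  [forall x, forall y, E x y ==> E y x].

Lemma qres_refl (P E : qposet) : reflexive (fun x y => P x y && E x y).
Proof. by move=> x; rewrite !qrefl. Qed.

Lemma qres_trans (P E : qposet) : transitive (fun x y => P x y && E x y).
Proof.
move=> y x z /andP[p e] /andP[p' e'].
by rewrite (qtrans p p') (qtrans e e').
Qed.

(* P | E *)
Definition qres (P E : qposet) : qposet :=
  qposet_of (qres_refl P E) (qres_trans (P := P) (E := E)).

Definition qquo_rel (P E : qposet) : rel T :=
  connect [rel x y | P x y || E x y].

(* P / E *)
Definition qquo (P E : qposet) : qposet :=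
  qposet_of (@connect0 _ _ : reflexive (qquo_rel P E))
            (@connect_trans _ _ : transitive (qquo_rel P E)).

End QuasiPoset.

Section Pullback.
Variables (T U : finType) (f : U -> T) (P : qposet T).

Lemma qpull_refl : reflexive (fun x y => P (f x) (f y)).
Proof. by move=> x; rewrite qrefl. Qed.

Lemma qpull_trans : transitive (fun x y => P (f x) (f y)).
Proof. by move=> y x z; apply: qtrans. Qed.

Definition qpull : qposet U := qposet_of qpull_refl qpull_trans.

Lemma qpullE x y : qpull x y = P (f x) (f y).
Proof. exact: qposet_ofE. Qed.

End Pullback.

Definition qrestr (T : finType) (P : qposet T) (B : {set T}) :
  qposet {x : T | x \in B} := qpull val P.

(* E <| P *)
Definition triangle (T : finType) (E P : qposet T) : bool :=
  [&& is_equiv E,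
      [forall x, qconnected (qrestr P [set y | E x y])] &
      [forall x, forall y, qsim (qquo P E) x y == E x y]].

Section DisjointUnion.
Variables (T U : finType) (P : qposet T) (Q : qposet U).

Definition qunion_rel : rel (T + U) := fun a b =>
  match a, b with
  | inl x, inl y => P x y
  | inr x, inr y => Q x y
  | _, _ => false
  end.

Lemma qunion_refl : reflexive qunion_rel.
Proof. by case=> x /=; rewrite qrefl. Qed.

Lemma qunion_trans : transitive qunion_rel.
Proof. by do 3![case=> ?] => //=; apply: qtrans. Qed.

Definition qunion : qposet (T + U)%type := qposet_of qunion_refl qunion_trans.

End DisjointUnion.

Definition qiso (T U : finType) (P : qposet T) (Q : qposet U) : bool :=
  [exists f : {ffun T -> U},
     [&& injectiveb f, #|T| == #|U| &
         [forall x, forall y, Q (f x) (f y) == P x y]]].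

Section Iso.

Lemma qisoP (T U : finType) (P : qposet T) (Q : qposet U) :
  reflect (exists2 f : T -> U, bijective f & forall x y, Q (f x) (f y) = P x y)
          (qiso P Q).
Proof.
apply: (iffP existsP) => [[f /and3P[/injectiveP fi /eqP c /forallP h]]|].
  exists f => [|x y]; last by apply/eqP; move: (h x) => /forallP.
  by apply: inj_card_bij => //; rewrite c.
case=> f bf h; exists [ffun x => f x]; apply/and3P; split.
- by apply/injectiveP=> x y; rewrite !ffunE; apply: bij_inj.
- exact/eqP/(bij_eq_card bf).
- by apply/forallP=> x; apply/forallP=> y; rewrite !ffunE h.
Qed.

Lemma qiso_refl (T : finType) (P : qposet T) : qiso P P.
Proof. by apply/qisoP; exists id => //; exists id. Qed.

Lemma qiso_symP (T U : finType) (P : qposet T) (Q : qposet U) :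
  qiso P Q -> qiso Q P.
Proof.
move=> /qisoP[f [g fK gK] h]; apply/qisoP; exists g; first by exists f.
by move=> x y; rewrite -h !gK.
Qed.

Lemma qiso_sym (T U : finType) (P : qposet T) (Q : qposet U) :
  qiso P Q = qiso Q P.
Proof. by apply/idP/idP; apply: qiso_symP. Qed.

Lemma qiso_trans (T U W : finType) (Q : qposet U) (P : qposet T)
    (S : qposet W) : qiso P Q -> qiso Q S -> qiso P S.
Proof.
move=> /qisoP[f bf hf] /qisoP[g bg hg]; apply/qisoP.
exists (g \o f); first exact: bij_comp.
by move=> x y; rewrite /= hg hf.
Qed.

Lemma qiso_pull (T U : finType) (f : U -> T) (P : qposet T) :
  bijective f -> qiso (qpull f P) P.
Proof. by move=> bf; apply/qisoP; exists f => // x y; rewrite qpullE. Qed.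

Lemma qiso_union (T T' U U' : finType) (P : qposet T) (P' : qposet T')
    (Q : qposet U) (Q' : qposet U') :
  qiso P P' -> qiso Q Q' -> qiso (qunion P Q) (qunion P' Q').
Proof.
move=> /qisoP[f [f' fK f'K] hf] /qisoP[g [g' gK g'K] hg]; apply/qisoP.
exists (fun a => match a with inl x => inl (f x) | inr y => inr (g y) end).
  exists (fun a => match a with inl x => inl (f' x) | inr y => inr (g' y) end).
    by case=> x; rewrite ?fK ?gK.
  by case=> x; rewrite ?f'K ?g'K.
by case=> x [] y; rewrite !qposet_ofE //= ?hf ?hg.
Qed.

Lemma qiso_unionA (T U W : finType) (P : qposet T) (Q : qposet U)
    (S : qposet W) : qiso (qunion P (qunion Q S)) (qunion (qunion P Q) S).
Proof.
apply/qisoP; exists (fun a => match a with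
  inl x => inl (inl x) | inr (inl y) => inl (inr y) | inr (inr z) => inr z end).
  exists (fun a => match a with
    inl (inl x) => inl x | inl (inr y) => inr (inl y) | inr z => inr (inr z)
    end); by do ?case.
by move=> [x|[x|x]] [y|[y|y]]; rewrite !qposet_ofE //= !qposet_ofE.
Qed.

Lemma qiso_unionC (T U : finType) (P : qposet T) (Q : qposet U) :
  qiso (qunion P Q) (qunion Q P).
Proof.
apply/qisoP; exists (fun a => match a with inl x => inr x | inr y => inl y end).
  exists (fun a => match a with inl x => inr x | inr y => inl y end); by case.
by move=> [x|x] [y|y]; rewrite !qposet_ofE.
Qed.

Lemma qiso_union0 (T U : finType) (P : qposet T) (Q : qposet U) :
  #|T| = 0%N -> qiso (qunion P Q) Q.
Proof.
move=> T0; rewrite qiso_sym; apply/qisoP; exists inr; last first.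
  by move=> x y; rewrite qposet_ofE.
by apply: inj_card_bij => [x y []//|]; rewrite card_sum T0.
Qed.

End Iso.

Definition qposet_ord : Type := {n : nat & qposet 'I_n}.
HB.instance Definition _ := Choice.on qposet_ord.

Definition qiso_ord (a b : qposet_ord) : bool := qiso (tagged a) (tagged b).

Lemma qiso_ord_refl : reflexive qiso_ord.
Proof. by move=> a; apply: qiso_refl. Qed.

Lemma qiso_ord_sym : symmetric qiso_ord.
Proof. by move=> a b; apply: qiso_sym. Qed.

Lemma qiso_ord_trans : transitive qiso_ord.
Proof. by move=> b a c; apply: qiso_trans. Qed.

Canonical qiso_equiv : equiv_rel qposet_ord :=
  EquivRel qiso_ord qiso_ord_refl qiso_ord_sym qiso_ord_trans.

(* Isoclasses of quasi-posets: every finite quasi-poset is isomorphic to one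
   carried by some 'I_n, and [qclass] sends a quasi-poset on an arbitrary
   finType to its isoclass (see [qclassP]). *)
Definition qp : Type := {eq_quot qiso_equiv}.
HB.instance Definition _ : EqQuotient _ qiso_equiv qp := EqQuotient.on qp.
HB.instance Definition _ := Choice.on qp.

Definition qclass (T : finType) (P : qposet T) : qp :=
  \pi_qp (Tagged (fun n => qposet 'I_n)
           (qpull (enum_val : 'I_#|T| -> T) P)).

Definition qrepr (c : qp) : qposet 'I_(tag (repr c)) := tagged (repr c).

Lemma qclassP (T U : finType) (P : qposet T) (Q : qposet U) :
  qclass P = qclass Q <->
  exists2 f : T -> U, bijective f & forall x y, Q (f x) (f y) = P x y.
Proof.
have iP := qiso_pull P (enum_val_bij T).
have iQ := qiso_pull Q (enum_val_bij U).
split=> [/eqmodP h|h]; [apply/qisoP | apply/eqmodP].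
  rewrite qiso_sym in iP; apply: qiso_trans iP _.
  exact: qiso_trans h iQ.
move/qisoP: h => h; apply: qiso_trans iP _; apply: qiso_trans h _.
by rewrite qiso_sym.
Qed.

Lemma qclass_iso (T U : finType) (P : qposet T) (Q : qposet U) :
  qiso P Q -> qclass P = qclass Q.
Proof. by move=> /qisoP/qclassP. Qed.

Lemma qreprK (c : qp) : qclass (qrepr c) = c.
Proof.
rewrite -[RHS]reprK; apply/eqmodP.
exact: (qiso_pull (qrepr c) (enum_val_bij _)).
Qed.

Lemma qrepr_iso (T : finType) (P : qposet T) : qiso (qrepr (qclass P)) P.
Proof. by apply/qisoP/qclassP; rewrite qreprK. Qed.

Lemma qempty_refl : reflexive (fun _ _ : void => true). Proof. by []. Qed.
Lemma qempty_trans : transitive (fun _ _ : void => true). Proof. by []. Qed.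

Definition qempty : qposet void := qposet_of qempty_refl qempty_trans.

Definition qp_one : qp := qclass qempty.

Definition qp_mul (c d : qp) : qp := qclass (qunion (qrepr c) (qrepr d)).

Lemma qp_mulE (T U : finType) (P : qposet T) (Q : qposet U) :
  qp_mul (qclass P) (qclass Q) = qclass (qunion P Q).
Proof. by apply: qclass_iso; apply: qiso_union; apply: qrepr_iso. Qed.

Lemma qp_mulA : associative qp_mul.
Proof.
move=> a b c; rewrite -[a]qreprK -[b]qreprK -[c]qreprK !qp_mulE.
exact/qclass_iso/qiso_unionA.
Qed.

Lemma qp_mulC : commutative qp_mul.
Proof. by move=> a b; apply/qclass_iso/qiso_unionC. Qed.

Lemma qp_mul1 : left_id qp_one qp_mul.
Proof.
move=> a; rewrite -[a]qreprK qp_mulE.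
by apply/qclass_iso/qiso_union0/card_void.
Qed.

Lemma qp_mul1r : right_id qp_one qp_mul.
Proof. by move=> a; rewrite qp_mulC qp_mul1. Qed.

Lemma qclass_eq1 (T : finType) (P : qposet T) :
  (qclass P == qp_one) = (#|T| == 0%N).
Proof.
apply/eqP/eqP => [/qclassP[f bf _]|T0].
  by rewrite (bij_eq_card bf) card_void.
have fv (x : T) : void by have := card0_eq T0 x; rewrite inE.
apply/qclassP; exists fv => [|x]; last by case: (fv x).
by apply: inj_card_bij => [x|]; [case: (fv x) | rewrite card_void].
Qed.

Lemma qp_unit a b : qp_mul a b = qp_one -> a = qp_one /\ b = qp_one.
Proof.
rewrite -[a]qreprK -[b]qreprK qp_mulE => /eqP; rewrite qclass_eq1 card_sum.
by rewrite addn_eq0 -!(qclass_eq1 (qrepr _)) => /andP[/eqP-> /eqP->].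
Qed.

HB.instance Definition _ := Choice_isMonomialDef.Build qp
  qp_mulA qp_mul1 qp_mul1r qp_unit.
HB.instance Definition _ := MonomialDef_isConomialDef.Build qp qp_mulC.

Section LinearAlgebra.
Variables (K : fieldType) (M : lmodType K).

Inductive span (S : M -> Prop) : M -> Prop :=
| span0 : span S 0
| span_cons c u v : S u -> span S v -> span S (c *: u + v).

Definition direct_sum (I : choiceType) (W : I -> M -> Prop) (U : M -> Prop) :
    Prop :=
  [/\ forall i x, W i x -> U x,
      forall x, U x -> exists (F : {fset I}) (f : I -> M),
        (forall i, W i (f i)) /\ x = \sum_(i <- F) f i &
      forall (F : {fset I}) (f : I -> M), (forall i, W i (f i)) ->
        \sum_(i <- F) f i = 0 -> forall i, i \in F -> f i = 0].

Definition is_basis (I : choiceType) (g : I -> M) (U : M -> Prop) : Prop :=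
  [/\ forall i, U (g i),
      forall x, U x -> exists (F : {fset I}) (c : I -> K),
        x = \sum_(i <- F) c i *: g i &
      forall (F : {fset I}) (c : I -> K),
        \sum_(i <- F) c i *: g i = 0 -> forall i, i \in F -> c i = 0].

End LinearAlgebra.

Inductive subalg (K : fieldType) (A : algType K) (S : A -> Prop) : A -> Prop :=
| subalg_gen x : S x -> subalg S x
| subalg1 : subalg S 1
| subalgD x y : subalg S x -> subalg S y -> subalg S (x + y)
| subalgZ c x : subalg S x -> subalg S (c *: x)
| subalgM x y : subalg S x -> subalg S y -> subalg S (x * y).

Section FreeModule.
Variable K : fieldType.

Section LinearExtension.
Variables (X : choiceType) (M : lmodType K) (h : X -> M).

Definition lext (u : {malg K[X]}) : M := \sum_(x <- msupp u) u@_x *: h x.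

Lemma lextEw (d : {fset X}) u : (msupp u `<=` d)%fset ->
  lext u = \sum_(x <- d) u@_x *: h x.
Proof.
move=> le; rewrite /lext [LHS](big_fset_incl _ le) => //= x xd.
by move/mcoeff_outdom=> ->; rewrite scale0r.
Qed.

Lemma lext_is_linear : linear lext.
Proof.
move=> c u v; set d := (msupp u `|` msupp v `|` msupp (c *: u + v))%fset.
rewrite !(@lextEw d) /d; first last.
- exact: fsubsetUr.
- by apply: fsubset_trans (fsubsetUl _ _); apply: fsubsetUl.
- by apply: fsubset_trans (fsubsetUl _ _); apply: fsubsetUr.
rewrite scaler_sumr -big_split /=; apply: eq_bigr => x _.
by rewrite mcoeffD mcoeffZ scalerDl scalerA.
Qed.

HB.instance Definition _ :=
  GRing.isLinear.Build K {malg K[X]} M *:%R lext lext_is_linear.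

Lemma lextU x : lext << x >> = h x.
Proof. by rewrite (lextEw msuppU_le) big_seq_fset1 mcoeffUU scale1r. Qed.

End LinearExtension.

(* The tensor product of the spaces with bases X and Y is the space with basis
   X * Y; the tensor product of the monoid algebras of X and Y is the monoid
   algebra of the product monoid. *)
Definition tens (X Y : choiceType) (u : {malg K[X]}) (v : {malg K[Y]}) :
    {malg K[(X * Y)%type]} :=
  \sum_(x <- msupp u) \sum_(y <- msupp v) << u@_x * v@_y *g (x, y) >>.

Definition tmap (X Y X' Y' : choiceType)
    (f : {malg K[X]} -> {malg K[X']}) (g : {malg K[Y]} -> {malg K[Y']}) :
    {malg K[(X * Y)%type]} -> {malg K[(X' * Y')%type]} :=
  lext (fun p => tens (f << p.1 >>) (g << p.2 >>)).

Definition tassoc (X Y Z : choiceType) :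
    {malg K[(X * Y * Z)%type]} -> {malg K[(X * (Y * Z))%type]} :=
  lext (fun p => << (p.1.1, (p.1.2, p.2)) >>).

(* f (x) Id and Id (x) f for a linear form f, through K (x) V = V = V (x) K *)
Definition tforml (X Y : choiceType) (f : {malg K[X]} -> K) :
    {malg K[(X * Y)%type]} -> {malg K[Y]} :=
  lext (fun p => f << p.1 >> *: << p.2 >>).

Definition tformr (X Y : choiceType) (f : {malg K[Y]} -> K) :
    {malg K[(X * Y)%type]} -> {malg K[X]} :=
  lext (fun p => f << p.2 >> *: << p.1 >>).

Definition tspan (X Y : choiceType) (S : {malg K[X]} -> Prop)
    (S' : {malg K[Y]} -> Prop) : {malg K[(X * Y)%type]} -> Prop :=
  span (fun t => exists u v, [/\ S u, S' v & t = tens u v]).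

End FreeModule.

Section ProductMonoid.
Variables X Y : monomType.

Definition pmul (a b : X * Y) : X * Y := (mmul a.1 b.1, mmul a.2 b.2).

Lemma pmulA : associative pmul.
Proof. by move=> a b c; rewrite /pmul !mulmA. Qed.

Lemma pmul1 : left_id (mone, mone) pmul.
Proof. by case=> a b; rewrite /pmul !mul1m. Qed.

Lemma pmulr1 : right_id (mone, mone) pmul.
Proof. by case=> a b; rewrite /pmul !mulm1. Qed.

Lemma pmul_unit a b : pmul a b = (mone, mone) ->
  a = (mone, mone) /\ b = (mone, mone).
Proof.
by case: a b => [a a'] [b b'] [] /unitm[/= -> ->] /unitm[/= -> ->].
Qed.

HB.instance Definition _ := Choice_isMonomialDef.Build (X * Y)%type
  pmulA pmul1 pmulr1 pmul_unit.

End ProductMonoid.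

HB.instance Definition _ (X Y : conomType) :=
  MonomialDef_isConomialDef.Build (X * Y)%type
    (fun a b : X * Y => congr2 pair (mulmC a.1 b.1) (mulmC a.2 b.2)).

Section Bialgebra.
Variable K : fieldType.

Definition tmul (X : monomType) : {malg K[(X * X)%type]} -> {malg K[X]} :=
  lext (fun p => << p.1 >> * << p.2 >>).

(* The algebras considered here are monoid algebras, so the product and the
   unit, both of A and of A (x) A, come from the ring structure of {malg K[X]}
   and {malg K[X * X]}. *)
Record is_bialgebra (X : monomType)
    (D : {linear {malg K[X]} -> {malg K[(X * X)%type]}})
    (e : {scalar {malg K[X]}}) : Prop := {
  bialg_coassoc x : tassoc (tmap D idfun (D x)) = tmap idfun D (D x);
  bialg_counitl x : tforml e (D x) = x;
  bialg_counitr x : tformr e (D x) = x;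
  bialg_comul : monoid_morphism D;
  bialg_counit : monoid_morphism e
}.

Definition is_antipode (X : monomType)
    (D : {linear {malg K[X]} -> {malg K[(X * X)%type]}})
    (e : {scalar {malg K[X]}}) (S : {linear {malg K[X]} -> {malg K[X]}}) :
    Prop :=
  forall x, tmul (tmap S idfun (D x)) = (e x)%:A /\
            tmul (tmap idfun S (D x)) = (e x)%:A.

Definition tmul324 (X Y : monomType) :
    {malg K[((X * Y) * (X * Y))%type]} -> {malg K[(X * X * Y)%type]} :=
  lext (fun p =>
    tens (tens << p.1.1 >> << p.2.1 >>) (<< p.1.2 >> * << p.2.2 >>)).

Record cointeraction (X Y : monomType)
    (DA : {linear {malg K[X]} -> {malg K[(X * X)%type]}})
    (eA : {scalar {malg K[X]}})
    (DB : {linear {malg K[Y]} -> {malg K[(Y * Y)%type]}})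
    (eB : {scalar {malg K[Y]}})
    (rho : {linear {malg K[X]} -> {malg K[(X * Y)%type]}}) : Prop := {
  coint_bialgA : is_bialgebra DA eA;
  coint_bialgB : is_bialgebra DB eB;
  coint_coact x : tassoc (tmap rho idfun (rho x)) = tmap idfun DB (rho x);
  coint_counit x : tformr eB (rho x) = x;
  coint_one : rho 1 = tens 1 1;
  coint_comul x : tmul324 (tmap rho rho (DA x)) = tmap DA idfun (rho x);
  coint_mul x y : rho (x * y) = rho x * rho y;
  coint_counitA x : tforml eA (rho x) = (eA x)%:A
}.

Record is_graded_algebra (X : monomType) (A : nat -> {malg K[X]} -> Prop) :
    Prop := {
  gralg_direct : direct_sum A (fun _ => True);
  gralg_one : A 0%N 1;
  gralg_mul m n x y : A m x -> A n y -> A (m + n)%N (x * y)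
}.

Record is_graded_connected_hopf (X : monomType)
    (A : nat -> {malg K[X]} -> Prop)
    (D : {linear {malg K[X]} -> {malg K[(X * X)%type]}})
    (e : {scalar {malg K[X]}}) : Prop := {
  grhopf_bialg : is_bialgebra D e;
  grhopf_alg : is_graded_algebra A;
  grhopf_comul n x : A n x ->
    span (fun t => exists i j u v,
      [/\ (i + j)%N = n, A i u, A j v & t = tens u v]) (D x);
  grhopf_counit n x : (0 < n)%N -> A n x -> e x = 0;
  grhopf_antipode : exists S : {linear {malg K[X]} -> {malg K[X]}},
    is_antipode D e S /\ forall n x, A n x -> A n (S x);
  grhopf_connected x : A 0%N x <-> exists c : K, x = c%:A
}.

End Bialgebra.

Section QuotientAlgebra.
Variables (K : fieldType) (R : comAlgType K) (I : idealr R).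

Definition quot_alg : Type := {ideal_quot I}.

HB.instance Definition _ := GRing.ComNzRing.on quot_alg.

Definition quot_pi : {rmorphism R -> quot_alg} := \pi_{ideal_quot I}.

Definition quot_scale (c : K) (x : quot_alg) : quot_alg := quot_pi c%:A * x.

Lemma quot_scaleA a b x :
  quot_scale a (quot_scale b x) = quot_scale (a * b) x.
Proof.
rewrite /quot_scale mulrA; congr (_ * x).
by rewrite -(rmorphM quot_pi) -scalerAl mul1r scalerA.
Qed.

Lemma quot_scale1 : left_id 1 quot_scale.
Proof. by move=> x; rewrite /quot_scale scale1r rmorph1 mul1r. Qed.

Lemma quot_scaleDr : right_distributive quot_scale +%R.
Proof. by move=> c x y; rewrite /quot_scale mulrDr. Qed.

Lemma quot_scaleDl x : {morph quot_scale^~ x : a b / a + b}.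
Proof. by move=> a b; rewrite /quot_scale scalerDl rmorphD mulrDl. Qed.

HB.instance Definition _ := GRing.Zmodule_isLmodule.Build K quot_alg
  quot_scaleA quot_scale1 quot_scaleDr quot_scaleDl.

Lemma quot_scaleAl (c : K) (x y : quot_alg) : c *: (x * y) = (c *: x) * y.
Proof. exact: mulrA. Qed.

HB.instance Definition _ :=
  GRing.Lmodule_isLalgebra.Build K quot_alg quot_scaleAl.
HB.instance Definition _ := GRing.Lalgebra_isComAlgebra.Build K quot_alg.

End QuotientAlgebra.

Section SymmetricAlgebra.
Variables (K : fieldType) (W : lmodType K).

(* The symmetric algebra of W: the commutative algebra generated by one
   variable [symX w] for each w : W, modulo linearity of w |-> symX w. *)
Local Notation F := {malg K[{cmonom W}]}.

Definition symX (w : W) : F := << ucm w >>.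

Inductive sym_rel : F -> Prop :=
| sym_rel0 : sym_rel 0
| sym_rel_cons p q c u v : sym_rel q ->
    sym_rel (p * (symX (c *: u + v) - (c *: symX u + symX v)) + q).

Definition sym_ideal : {pred F} := fun p => `[< sym_rel p >].

Lemma sym_ideal_closed : idealr_closed sym_ideal.
Proof.
split.
- exact/asboolP/sym_rel0.
- apply/asboolPn => h.
  have cX w : (symX w)@_mone = 0 :> K.
    rewrite mcoeffU1 /=; case: eqP => // h1.
    by have := congr1 (fun m : {cmonom W} => m w) h1; rewrite /= ucmE eqxx cm1.
  have lin (p x y z : F) c : x@_mone = 0 -> y@_mone = 0 -> z@_mone = 0 ->
      (p * (x - (c *: y + z)))@_mone = 0.
    move=> x0 y0 z0; rewrite (rmorphM (mcoeff (mone : {cmonom W}))) /=.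
    by rewrite mcoeffB mcoeffD mcoeffZ x0 y0 z0 mulr0 addr0 subr0 mulr0.
  have c0 p : sym_rel p -> p@_mone = 0 :> K.
    elim=> [|p' q c u v _ IH]; first exact: mcoeff0.
    by rewrite mcoeffD IH addr0 lin.
  by move/eqP: (c0 _ h); rewrite mcoeff1 eqxx oner_eq0.
- move=> a p q /asboolP hp /asboolP hq; apply/asboolP.
  elim: hp => [|p' r c u v _ IH]; first by rewrite mulr0 add0r.
  by rewrite mulrDr -addrA mulrA; apply: sym_rel_cons.
Qed.

HB.instance Definition _ := isIdealr.Build F sym_ideal sym_ideal_closed.

Definition Sym : Type := quot_alg sym_ideal.

HB.instance Definition _ := GRing.ComAlgebra.on Sym.

Definition sym_gen (w : W) : Sym := quot_pi sym_ideal (symX w).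

Lemma sym_gen_is_linear : linear sym_gen.
Proof.
move=> c u v; apply/eqP; rewrite -subr_eq0; apply/eqP.
have -> : c *: sym_gen u = quot_pi sym_ideal (c *: symX u).
  rewrite -[c *: symX u]mul1r -scalerAr scalerAl.
  by rewrite (rmorphM (quot_pi sym_ideal)).
rewrite -(rmorphD (quot_pi sym_ideal)) -(rmorphB (quot_pi sym_ideal)).
rewrite -[RHS](rmorph0 (quot_pi sym_ideal)); apply/eqP; rewrite -Quotient.idealrBE subr0.
apply/asboolP; rewrite -[X in sym_rel X]addr0 -[X in X + 0]mul1r.
by apply: sym_rel_cons; apply: sym_rel0.
Qed.

(* The grading of the symmetric algebra induced by a grading Wd of W. *)
Definition sym_deg (Wd : nat -> W -> Prop) (n : nat) : Sym -> Prop :=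
  span (fun y => exists s : seq (nat * W),
    [/\ forall p, p \in s -> Wd p.1 p.2,
        (\sum_(p <- s) p.1)%N = n &
        y = \prod_(p <- s) sym_gen p.2]).

End SymmetricAlgebra.

(* A linear subspace V, as a space of its own. *)
Definition subspace (K : fieldType) (A : lmodType K) (V : submodClosed A) :
  Type := {x : A | x \in V}.

Section Subspace.
Variables (K : fieldType) (A : lmodType K) (V : submodClosed A).
HB.instance Definition _ := SubChoice.on (subspace V).
HB.instance Definition _ := [SubChoice_isSubLmodule of subspace V by <:].
End Subspace.

Lemma qisoW (A : Type) (h : forall T : finType, qposet T -> A) :
  (forall (T U : finType) (f : U -> T), bijective f ->
     forall P : qposet T, h U (qpull f P) = h T P) ->
  forall (T U : finType) (P : qposet T) (Q : qposet U),
    qclass P = qclass Q -> h T P = h U Q.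
Proof.
move=> hf T U P Q /qclassP[f bf fP]; rewrite -(hf _ _ f bf Q); congr (h T).
by apply: qposetP => x y; rewrite qpullE fP.
Qed.

Section Pull.
Variables (T U : finType) (f : U -> T).
Hypothesis bf : bijective f.
Implicit Types P E : qposet T.

Lemma forall_pull (p : pred T) : [forall x, p (f x)] = [forall x, p x].
Proof.
have [g fK gK] := bf.
by apply/forallP/forallP => h x; [rewrite -[x]gK|]; apply: h.
Qed.

Lemma forall2_pull (p : T -> T -> bool) :
  [forall x, forall y, p (f x) (f y)] = [forall x, forall y, p x y].
Proof.
rewrite -(forall_pull (fun x => [forall y, p x y])).
by apply: eq_forallb => x; rewrite (forall_pull (p (f x))).
Qed.

Lemma qsim_pull P x y : qsim (qpull f P) x y = qsim P (f x) (f y).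
Proof. by rewrite /qsim !qpullE. Qed.

Lemma qdiscrete_pull P : qdiscrete (qpull f P) = qdiscrete P.
Proof.
rewrite /qdiscrete -(forall2_pull (fun x y => P x y == qsim P x y)).
by do 2!apply: eq_forallb => ?; rewrite qpullE qsim_pull.
Qed.

Lemma preimset_bij : bijective (fun O : {set T} => f @^-1: O).
Proof.
have [g fK gK] := bf; exists (fun O : {set U} => g @^-1: O) => O.
  by apply/setP => x; rewrite !inE gK.
by apply/setP => x; rewrite !inE fK.
Qed.

Lemma cl_pull P : cl (qpull f P) = cl P.
Proof.
have [g fK gK] := bf; rewrite /cl -[RHS](card_imset _ (bij_inj preimset_bij)).
congr #|pred_of_set _|; apply/setP => B; apply/imsetP/imsetP.
  case=> x _ ->; exists [set y | qsim P (f x) y]; first exact: imset_f.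
  by apply/setP => y; rewrite !inE qsim_pull.
case=> _ /imsetP[x _ ->] ->; exists (g x) => //.
by apply/setP => y; rewrite !inE qsim_pull gK.
Qed.

Lemma qtop_pull P (O : {set T}) :
  (f @^-1: O \in qtop (qpull f P)) = (O \in qtop P).
Proof.
rewrite !inE -(forall2_pull (fun i j => (i \in O) && P i j ==> (j \in O))).
by do 2!apply: eq_forallb => ?; rewrite qpullE !inE.
Qed.

Lemma qconnected_pull P : qconnected (qpull f P) = qconnected P.
Proof.
rewrite /qconnected.
have [h hK Kh] := preimset_bij.
have aux (O : {set T}) :
    (f @^-1: O \in qtop (qpull f P)) && (~: (f @^-1: O) \in qtop (qpull f P))
      ==> (f @^-1: O == set0) || (f @^-1: O == setT) =
    ((O \in qtop P) && (~: O \in qtop P) ==> (O == set0) || (O == setT)).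
  rewrite -preimsetC !qtop_pull -(preimset0 f) -(preimsetT f).
  by rewrite !(inj_eq (bij_inj preimset_bij)).
by apply/forallP/forallP => H O; [rewrite -aux | rewrite -[O]Kh aux].
Qed.

Lemma qrestr_pull P (B : {set T}) :
  qclass (qrestr (qpull f P) (f @^-1: B)) = qclass (qrestr P B).
Proof.
have [g fK gK] := bf; apply/qclassP.
have fB (x : {x : U | x \in f @^-1: B}) : f (val x) \in B.
  by have := valP x; rewrite inE.
have gB (y : {y : T | y \in B}) : g (val y) \in f @^-1: B.
  by rewrite inE gK (valP y).
exists (fun x => (Sub (f (val x)) (fB x) : {y : T | y \in B})); last by move=> x y; rewrite !qpullE.
exists (fun y => (Sub (g (val y)) (gB y) : {x : U | x \in f @^-1: B})) => x; apply: val_inj => /=.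
  exact: fK.
exact: gK.
Qed.

Lemma qquo_pull P E : qquo (qpull f P) (qpull f E) = qpull f (qquo P E).
Proof.
have [g fK gK] := bf; apply: qposetP => x y; rewrite qpullE !qposet_ofE.
apply/connectP/connectP => -[p pp lp].
  exists (map f p); last by rewrite last_map lp.
  elim: p x pp {lp} => //= z p IH x /andP[xz pz].
  by rewrite IH // andbT -!qpullE.
exists (map g p); last by rewrite -[x]fK last_map -lp fK.
rewrite -[x]fK; elim: p (f x) pp {lp} => //= z p IH x' /andP[xz pz].
by rewrite IH // andbT !qpullE !gK.
Qed.

End Pull.

Lemma triangle_pull (T U : finType) (f : U -> T) (bf : bijective f)
    (P E : qposet T) : triangle (qpull f E) (qpull f P) = triangle E P.
Proof.
congr [&& _, _ & _].
- rewrite /is_equiv -(forall2_pull bf (fun x y => E x y ==> E y x)).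
  by do 2!apply: eq_forallb => ?; rewrite !qpullE.
- rewrite -(forall_pull bf (fun x => qconnected (qrestr P [set y | E x y]))).
  apply: eq_forallb => x.
  rewrite -(qisoW qconnected_pull (qrestr_pull bf P [set y | E (f x) y])).
  by congr (qconnected (qrestr _ _)); apply/setP=> y; rewrite !inE qpullE.
- rewrite -(forall2_pull bf (fun x y => qsim (qquo P E) x y == E x y)).
  by do 2!apply: eq_forallb => ?; rewrite qquo_pull // qsim_pull qpullE.
Qed.

Notation Hqp K := {malg K[qp]}.
Notation Hqp2 K := {malg K[(qp * qp)%type]}.

Section Hqp.
Variable K : fieldType.

Local Notation "'[' P ']'" := (<< qclass P >> : Hqp K).

Definition Delta_qposet (T : finType) (P : qposet T) : Hqp2 K :=
  \sum_(O in qtop P) tens [qrestr P (~: O)] [qrestr P O].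

Definition delta_qposet (T : finType) (P : qposet T) : Hqp2 K :=
  \sum_(E : qposet T | triangle E P) tens [qquo P E] [qres P E].

(* The structure maps are linear extensions of maps defined on a chosen
   representative of each isoclass; DeltaE, deltaE, epsDeltaE, epsdeltaE and
   qp_clE show that any representative can be used. *)
Definition Delta : Hqp K -> Hqp2 K := lext (fun c => Delta_qposet (qrepr c)).

HB.instance Definition _ := GRing.Linear.on Delta.

Definition delta : Hqp K -> Hqp2 K := lext (fun c => delta_qposet (qrepr c)).

HB.instance Definition _ := GRing.Linear.on delta.

Definition epsDelta : Hqp K -> K :=
  lext (M := K^o) (fun c => (c == qp_one)%:R).

Lemma epsDelta_is_scalar : scalar epsDelta.
Proof. exact: (lext_is_linear (M := K^o)). Qed.

HB.instance Definition _ :=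
  GRing.isLinear.Build K (Hqp K) K *%R epsDelta epsDelta_is_scalar.

Definition epsdelta : Hqp K -> K :=
  lext (M := K^o) (fun c => (qdiscrete (qrepr c))%:R).

Lemma epsdelta_is_scalar : scalar epsdelta.
Proof. exact: (lext_is_linear (M := K^o)). Qed.

HB.instance Definition _ :=
  GRing.isLinear.Build K (Hqp K) K *%R epsdelta epsdelta_is_scalar.

Definition qp_cl (c : qp) : nat := cl (qrepr c).

Definition hqp_deg (n : nat) : Hqp K -> Prop :=
  span (fun x => exists P : qp, qp_cl P = n /\ x = << P >>).

Lemma DeltaE (T : finType) (P : qposet T) : Delta [P] = Delta_qposet P.
Proof.
rewrite /Delta lextU; apply: qisoW (qreprK _) => {}T U f bf {}P.
rewrite /Delta_qposet (reindex _ (onW_bij _ (preimset_bij bf))) /=.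
apply: eq_big => [O|O _]; first exact: qtop_pull.
by rewrite -preimsetC !qrestr_pull.
Qed.

Lemma qpull_bij (T U : finType) (f : U -> T) :
  bijective f -> bijective (qpull f).
Proof.
case=> g fK gK; exists (qpull g) => E; apply: qposetP => x y.
  by rewrite !qpullE !gK.
by rewrite !qpullE !fK.
Qed.

Lemma qclass_pull (T U : finType) (f : U -> T) (P : qposet T) :
  bijective f -> qclass (qpull f P) = qclass P.
Proof. by move=> bf; apply/qclass_iso/qiso_pull. Qed.

Lemma deltaE (T : finType) (P : qposet T) : delta [P] = delta_qposet P.
Proof.
rewrite /delta lextU; apply: qisoW (qreprK _) => {}T U f bf {}P.
rewrite /delta_qposet (reindex _ (onW_bij _ (qpull_bij bf))) /=.
apply: eq_big => [E|E _]; first exact: triangle_pull.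
congr (tens << _ >> << _ >>); rewrite -[RHS](qclass_pull _ bf).
  by rewrite qquo_pull.
by congr qclass; apply: qposetP => x y; rewrite ?(qposet_ofE, qpullE).
Qed.

Lemma epsDeltaE (T : finType) (P : qposet T) :
  epsDelta [P] = (#|T| == 0%N)%:R.
Proof. by rewrite /epsDelta (lextU (M := K^o)) qclass_eq1. Qed.

Lemma epsdeltaE (T : finType) (P : qposet T) :
  epsdelta [P] = (qdiscrete P)%:R.
Proof.
rewrite /epsdelta (lextU (M := K^o)); congr (_%:R).
by rewrite (qisoW qdiscrete_pull (qreprK (qclass P))).
Qed.

Lemma qp_clE (T : finType) (P : qposet T) : qp_cl (qclass P) = cl P.
Proof. exact: (qisoW cl_pull (qreprK (qclass P))). Qed.

Lemma mulqE (T U : finType) (P : qposet T) (Q : qposet U) :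
  [P] * [Q] = [qunion P Q].
Proof. by rewrite malgM_def fgmulUU mulr1 -qp_mulE. Qed.

(* The homogeneous component V_n of a subspace V. *)
Definition hpart (V : submodClosed (Hqp K)) (n : nat) (x : Hqp K) : Prop :=
  x \in V /\ hqp_deg n x.

(* The subalgebra S(V_1 + ... + V_(n-1)). *)
Definition sublt (V : submodClosed (Hqp K)) (n : nat) : Hqp K -> Prop :=
  subalg (span (fun x => exists k, (1 <= k < n)%N /\ hpart V k x)).

Definition gpow (I : choiceType) (g : I -> Hqp K)
    (a : {fsfun I -> nat with 0%N}) : Hqp K :=
  \prod_(i <- finsupp a) g i ^+ a i.

End Hqp.

Arguments Delta : clear implicits.
Arguments delta : clear implicits.
Arguments epsDelta : clear implicits.
Arguments epsdelta : clear implicits.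
Arguments hqp_deg : clear implicits.

(* Main.v *)
Require Import Defs.
From HB Require Import structures.
From mathcomp Require Import all_boot all_order all_algebra.
From mathcomp Require Import generic_quotient ring_quotient.
From mathcomp Require Import finmap monalg boolp.

(** Let [zz P] be the equivalence whose classes are the connected components of
    [P], and [qcore P] the equivalence [~P] of [P]. The condition [E <| P] means
    that [E] is contained in [zz (P|E)] and contains the equivalence of [P/E]
    ([triangleP]); so [qcore P] and [zz P] are the least and the greatest such
    [E].

    Both sides of the coassociativity of [delta] are sums over pairs [E], [F] of
    equivalences, and the two sums agree term by term: contracting [E] and then
    [F] amounts to choosing [F] and then refining it by [E]
    ([triangle_exchange]), with [(P/E)/F = P/F], [(P/E)|F = (P|F)/E] and
    [(P|F)|E = P|E]. The counits select [E = zz P] and [E = qcore P].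
    In the same way the coassociativity of [Delta] is a sum over chains of open
    sets ([sum_open_chains]). For the cointeraction, a set [O] which is open in
    [P] is open in [P/E] exactly when it is a union of classes of [E]; then [E]
    is a pair of contractible equivalences, on [O] and on its complement
    ([sum_open_triangles], which rests on [sum_separated] for a quasi-poset on a
    disjoint union whose relations all go from left to right). Multiplicativity
    of [delta] is the special case without relations between the two sides.

    The antipode is a geometric series for the convolution product, finite in
    each degree by the grading ([takeuchi]). A quasi-poset is the disjoint union
    of its connected components in exactly one way, so the isoclasses form a
    free commutative monoid on the connected ones ([compM], [conn_ind]); taking
    for [V] the span of the connected isoclasses, this gives an inverse to the
    canonical morphism from the symmetric algebra of [V].

    Finally let [P] be connected with [n >= 2] classes. The terms of [delta P]
    for [E = zz P] and [E = qcore P] are [g_i (x) P], where [g_i] is the total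
    relation on the ground set, and [P (x) g_alpha], where [alpha] counts the
    classes of [~P] by cardinality. Any other [E] merges two classes of [~P] but
    does not merge all points, so that [P/E] and the connected components of
    [P|E] are connected with fewer than [n] classes ([sublt_quo],
    [sublt_res]). Thus [V_n] is graded by the labels [(i, alpha)] of the
    connected isoclasses. *)

Set Implicit Arguments.
Unset Strict Implicit.
Unset Printing Implicit Defensive.

Import GRing.Theory.
Local Open Scope ring_scope.

(** * Linear algebra on free modules and their tensor products *)

Section LinearExtensions.
Variable K : fieldType.

Lemma malgU_scale (X : choiceType) (c : K) (x : X) :
  << c *g x >> = c *: << x >>.
Proof. by apply/malgP => k; rewrite mcoeffZ !mcoeffU mulr_natr. Qed.

Lemma malg_sumE (X : choiceType) (u : {malg K[X]}) :
  u = \sum_(x <- msupp u) u@_x *: << x >>.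
Proof. by rewrite {1}[u]monalgE; apply: eq_bigr => x _; rewrite malgU_scale. Qed.

Lemma malg_ind (X : choiceType) (Q : {malg K[X]} -> Prop) :
  Q 0 -> (forall c x u, Q u -> Q (c *: << x >> + u)) -> forall u, Q u.
Proof.
move=> Q0 QS u; rewrite [u]malg_sumE.
elim: (enum_fset (msupp u)) => [|x s IH]; first by rewrite big_nil.
by rewrite big_cons; apply: QS.
Qed.

Lemma malg_ext (X : choiceType) (M : lmodType K)
    (f g : {linear {malg K[X]} -> M}) :
  (forall x, f << x >> = g << x >>) -> f =1 g.
Proof.
move=> h; elim/malg_ind => [|c x u IH]; first by rewrite !linear0.
by rewrite !linearP h IH.
Qed.

Section Tens.
Variables X Y : choiceType.
Implicit Types (u : {malg K[X]}) (v : {malg K[Y]}).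

Lemma mcoeff_tens u v p : (tens u v)@_p = u@_p.1 * v@_p.2.
Proof.
case: p => a b; rewrite /tens [in RHS](malg_sumE u) [in RHS](malg_sumE v) /=.
rewrite !raddf_sum /= mulr_suml; apply: eq_bigr => x _.
rewrite raddf_sum mulr_sumr; apply: eq_bigr => y _ /=.
rewrite mcoeffU !mcoeffZ !mcoeffU xpair_eqE.
by case: eqP; case: eqP; rewrite ?mulr0n ?mulr1n ?mulr0 ?mul0r ?mulr1.
Qed.

Lemma tensUU (x : X) (y : Y) : tens << x >> << y >> = << (x, y) >> :> {malg K[_]}.
Proof.
apply/malgP => -[a b]; rewrite mcoeff_tens !mcoeffU xpair_eqE -natrM.
by rewrite mulnb.
Qed.

Lemma tensPl c u u' v : tens (c *: u + u') v = c *: tens u v + tens u' v.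
Proof.
by apply/malgP => p; rewrite !(mcoeffD, mcoeffZ, mcoeff_tens) mulrDl mulrA.
Qed.

Lemma tensPr c u v v' : tens u (c *: v + v') = c *: tens u v + tens u v'.
Proof.
apply/malgP => p; rewrite !(mcoeffD, mcoeffZ, mcoeff_tens) mulrDr.
by rewrite mulrCA.
Qed.

HB.instance Definition _ (u : {malg K[X]}) :=
  GRing.isLinear.Build K {malg K[Y]} {malg K[(X * Y)%type]} *:%R (tens u)
    (fun c v v' => tensPr c u v v').

(** Multilinear identities are reduced to basis elements one variable at a time
    by [malg_ext]; this requires every partial application as a linear map,
    hence [tensl] and, for products, [mull] and [mulrl]. *)
Definition tensl (v : {malg K[Y]}) (u : {malg K[X]}) := tens u v.

HB.instance Definition _ (v : {malg K[Y]}) :=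
  GRing.isLinear.Build K {malg K[X]} {malg K[(X * Y)%type]} *:%R (tensl v)
    (fun c u u' => tensPl c u u' v).

Lemma tens0l v : tens (0 : {malg K[X]}) v = 0. Proof. exact: (linear0 (tensl v)). Qed.
Lemma tens0r u : tens u (0 : {malg K[Y]}) = 0. Proof. exact: (linear0 (tens u)). Qed.

Lemma tens_suml (I : Type) (r : seq I) (p : pred I) (F : I -> {malg K[X]}) v :
  tens (\sum_(i <- r | p i) F i) v = \sum_(i <- r | p i) tens (F i) v.
Proof. exact: (linear_sum (tensl v)). Qed.

Lemma tens_sumr (I : Type) (r : seq I) (p : pred I) u (F : I -> {malg K[Y]}) :
  tens u (\sum_(i <- r | p i) F i) = \sum_(i <- r | p i) tens u (F i).
Proof. exact: (linear_sum (tens u)). Qed.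

Lemma tensZl c u v : tens (c *: u) v = c *: tens u v.
Proof. by rewrite -[c *: u]addr0 tensPl tens0l addr0. Qed.

Lemma tensZr c u v : tens u (c *: v) = c *: tens u v.
Proof. by rewrite -[c *: v]addr0 tensPr tens0r addr0. Qed.

End Tens.

HB.instance Definition _ (X Y X' Y' : choiceType)
    (f : {malg K[X]} -> {malg K[X']}) (g : {malg K[Y]} -> {malg K[Y']}) :=
  GRing.Linear.on (tmap f g).
HB.instance Definition _ (X Y Z : choiceType) :=
  GRing.Linear.on (@tassoc K X Y Z).
HB.instance Definition _ (X Y : choiceType) (f : {malg K[X]} -> K) :=
  GRing.Linear.on (@tforml K X Y f).
HB.instance Definition _ (X Y : choiceType) (f : {malg K[Y]} -> K) :=
  GRing.Linear.on (@tformr K X Y f).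
HB.instance Definition _ (X : monomType) := GRing.Linear.on (@tmul K X).
HB.instance Definition _ (X Y : monomType) := GRing.Linear.on (@tmul324 K X Y).

Section Sums.
Variables (I : Type) (r : seq I) (p : pred I).

Lemma tmap_sum (X Y X' Y' : choiceType)
    (f : {malg K[X]} -> {malg K[X']}) (g : {malg K[Y]} -> {malg K[Y']}) F :
  tmap f g (\sum_(i <- r | p i) F i) = \sum_(i <- r | p i) tmap f g (F i).
Proof. exact: (linear_sum (tmap f g)). Qed.

Lemma tassoc_sum (X Y Z : choiceType) F :
  tassoc (\sum_(i <- r | p i) F i) =
  \sum_(i <- r | p i) tassoc (F i : {malg K[(X * Y * Z)%type]}).
Proof. exact: (linear_sum (@tassoc K X Y Z)). Qed.

Lemma tforml_sum (X Y : choiceType) (f : {malg K[X]} -> K) F :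
  tforml f (\sum_(i <- r | p i) F i) =
  \sum_(i <- r | p i) tforml f (F i : {malg K[(X * Y)%type]}).
Proof. exact: (linear_sum (@tforml K X Y f)). Qed.

Lemma tformr_sum (X Y : choiceType) (f : {malg K[Y]} -> K) F :
  tformr f (\sum_(i <- r | p i) F i) =
  \sum_(i <- r | p i) tformr f (F i : {malg K[(X * Y)%type]}).
Proof. exact: (linear_sum (@tformr K X Y f)). Qed.

Lemma tmul_sum (X : monomType) F :
  tmul (\sum_(i <- r | p i) F i) =
  \sum_(i <- r | p i) tmul (F i : {malg K[(X * X)%type]}).
Proof. exact: (linear_sum (@tmul K X)). Qed.

Lemma tmul324_sum (X Y : monomType) F :
  tmul324 (\sum_(i <- r | p i) F i) =
  \sum_(i <- r | p i) tmul324 (F i : {malg K[((X * Y) * (X * Y))%type]}).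
Proof. exact: (linear_sum (@tmul324 K X Y)). Qed.

End Sums.

Definition mull (X : conomType) (u v : {malg K[X]}) := u * v.

Lemma mull_is_linear (X : conomType) (u : {malg K[X]}) : linear (mull u).
Proof. by move=> c v w; rewrite /mull mulrDr -scalerAr. Qed.

HB.instance Definition _ (X : conomType) (u : {malg K[X]}) :=
  GRing.isLinear.Build K {malg K[X]} {malg K[X]} *:%R (mull u)
    (mull_is_linear u).

Definition mulrl (X : conomType) (v u : {malg K[X]}) := u * v.

Lemma mulrl_is_linear (X : conomType) (v : {malg K[X]}) : linear (mulrl v).
Proof. by move=> c u w; rewrite /mulrl mulrDl -scalerAl. Qed.

HB.instance Definition _ (X : conomType) (v : {malg K[X]}) :=
  GRing.isLinear.Build K {malg K[X]} {malg K[X]} *:%R (mulrl v)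
    (mulrl_is_linear v).

(** A linear map on a monoid algebra that is multiplicative on the basis is
    multiplicative. *)
Lemma malg_mul_ext (X : conomType) (B : algType K)
    (f : {linear {malg K[X]} -> B}) :
  (forall x y, f (<< x >> * << y >>) = f << x >> * f << y >>) ->
  forall u v, f (u * v) = f u * f v.
Proof.
move=> h u v; have fP c a b : f (c *: a + b) = c *: f a + f b := linearP f c a b.
have f0 : f 0 = 0 := linear0 f.
elim/malg_ind: u => [|c x u IH]; first by rewrite mul0r f0 mul0r.
rewrite mulrDl -scalerAl !fP IH mulrDl -scalerAl; congr (_ *: _ + _).
elim/malg_ind: v {IH} => [|d y v IH]; first by rewrite mulr0 f0 mulr0.
by rewrite mulrDr -scalerAr !fP IH mulrDr -scalerAr h.
Qed.

Lemma malgUM (X : monomType) (x y : X) :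
  << x >> * << y >> = << mmul x y >> :> {malg K[X]}.
Proof. by rewrite malgM_def fgmulUU mulr1. Qed.

Lemma lextM (X : conomType) (B : algType K) (h : X -> B) :
  (forall x y, h (mmul x y) = h x * h y) ->
  forall u v, lext h (u * v) = lext h u * lext h v.
Proof.
move=> hM; apply: malg_mul_ext => x y.
by rewrite malgUM /= !lextU.
Qed.

Lemma malg_form_ext (X : conomType) (e : {scalar {malg K[X]}}) :
  (forall x y, e (<< x >> * << y >>) = e << x >> * e << y >>) ->
  forall u v, e (u * v) = e u * e v.
Proof.
move=> h u v; have eP c a b : e (c *: a + b) = c * e a + e b := linearP e c a b.
have e0 : e 0 = 0 := linear0 e.
elim/malg_ind: u => [|c x u IH]; first by rewrite mul0r e0 mul0r.
rewrite mulrDl -scalerAl !eP IH mulrDl -mulrA; congr (_ * _ + _).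
elim/malg_ind: v {IH} => [|d y v IH]; first by rewrite mulr0 e0 mulr0.
by rewrite mulrDr -scalerAr !eP IH mulrDr mulrCA h.
Qed.

Lemma tmap_tens (X Y X' Y' : choiceType)
    (f : {linear {malg K[X]} -> {malg K[X']}})
    (g : {linear {malg K[Y]} -> {malg K[Y']}}) u v :
  tmap f g (tens u v) = tens (f u) (g v).
Proof.
apply: (malg_ext (f := tmap f g \o tensl v) (g := tensl (g v) \o f)) => x.
apply: (malg_ext (f := tmap f g \o tens << x >>)
                 (g := tens (f << x >>) \o g)) => y.
by rewrite /= tensUU /tmap lextU.
Qed.

Lemma tassoc_tens (X Y Z : choiceType) (u : {malg K[X]}) (v : {malg K[Y]})
    (w : {malg K[Z]}) : tassoc (tens (tens u v) w) = tens u (tens v w).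
Proof.
apply: (malg_ext (f := @tassoc K X Y Z \o (tensl w \o tensl v))
                 (g := tensl (tens v w))) => x.
apply: (malg_ext (f := @tassoc K X Y Z \o (tensl w \o tens << x >>))
                 (g := tens << x >> \o tensl w)) => y.
apply: (malg_ext (f := @tassoc K X Y Z \o tens (tens << x >> << y >>))
                 (g := tens << x >> \o tens << y >>)) => z.
by rewrite /= !tensUU /tassoc lextU.
Qed.

Lemma tforml_tens (X Y : choiceType) (e : {scalar {malg K[X]}})
    (u : {malg K[X]}) (v : {malg K[Y]}) : tforml e (tens u v) = e u *: v.
Proof.
rewrite [u]malg_sumE tens_suml !linear_sum scaler_suml.
apply: eq_bigr => x _; rewrite tensZl linearZ /= linearZ /= -scalerA.
congr (_ *: _); rewrite [v]malg_sumE tens_sumr linear_sum scaler_sumr.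
apply: eq_bigr => y _; rewrite tensZr linearZ /= tensUU /tforml lextU.
by rewrite !scalerA mulrC.
Qed.

Lemma tformr_tens (X Y : choiceType) (e : {scalar {malg K[Y]}})
    (u : {malg K[X]}) (v : {malg K[Y]}) : tformr e (tens u v) = e v *: u.
Proof.
rewrite [v]malg_sumE tens_sumr !linear_sum scaler_suml.
apply: eq_bigr => y _; rewrite tensZr linearZ /= linearZ /= -scalerA.
congr (_ *: _); rewrite [u]malg_sumE tens_suml linear_sum scaler_sumr.
apply: eq_bigr => x _; rewrite tensZl linearZ /= tensUU /tformr lextU.
by rewrite !scalerA mulrC.
Qed.

Lemma tmul_tens (X : conomType) (u v : {malg K[X]}) : tmul (tens u v) = u * v.
Proof.
have h1 : (@tmul K X \o tensl v) =1 mulrl v.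
  apply: malg_ext => x.
  have h2 : (@tmul K X \o tens << x >>) =1 mull << x >>.
    by apply: malg_ext => y; rewrite /= tensUU /tmul lextU.
  exact: h2 v.
exact: h1 u.
Qed.

Lemma tens11 (X Y : monomType) :
  tens 1 1 = 1 :> {malg K[(X * Y)%type]}.
Proof. exact: tensUU. Qed.

Lemma tensM (X Y : conomType) (u u' : {malg K[X]}) (v v' : {malg K[Y]}) :
  tens u v * tens u' v' = tens (u * u') (v * v').
Proof.
apply: (malg_ext (f := mulrl (tens u' v') \o tensl v)
                 (g := tensl (v * v') \o mulrl u')) => x.
apply: (malg_ext (f := mulrl (tens u' v') \o tens << x >>)
                 (g := tens (<< x >> * u') \o mulrl v')) => y.
apply: (malg_ext (f := mull (tens << x >> << y >>) \o tensl v')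
                 (g := tensl (<< y >> * v') \o mull << x >>)) => x'.
apply: (malg_ext (f := mull (tens << x >> << y >>) \o tens << x' >>)
                 (g := tens (<< x >> * << x' >>) \o mull << y >>)) => y'.
by rewrite /= /mull !tensUU !malgUM tensUU.
Qed.

Lemma tmul324_tens (X : monomType) (Y : conomType) (a a' : {malg K[X]})
    (b b' : {malg K[Y]}) :
  tmul324 (tens (tens a b) (tens a' b')) = tens (tens a a') (b * b').
Proof.
pose t := @tmul324 K X Y.
apply: (malg_ext (f := t \o (tensl (tens a' b') \o tensl b))
                 (g := tensl (b * b') \o tensl a')) => x.
apply: (malg_ext (f := t \o (tensl (tens a' b') \o tens << x >>))
                 (g := tens (tens << x >> a') \o mulrl b')) => y.
apply: (malg_ext (f := t \o (tens (tens << x >> << y >>) \o tensl b'))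
          (g := tensl (<< y >> * b') \o tens << x >>)) => x'.
apply: (malg_ext (f := t \o (tens (tens << x >> << y >>) \o tens << x' >>))
          (g := tens (tens << x >> << x' >>) \o mull << y >>)) => y'.
by rewrite /= /t !tensUU /tmul324 lextU /= tensUU.
Qed.

End LinearExtensions.

(** * Subspaces spanned by basis elements *)

Section Span.
Variables (K : fieldType) (M : lmodType K).
Implicit Type S : M -> Prop.

Lemma span_gen S x : S x -> Defs.span S x.
Proof.
by move=> Sx; rewrite -[x]scale1r -[_ *: _]addr0; apply: Defs.span_cons => //; exact: Defs.span0.
Qed.

Lemma spanD S x y : Defs.span S x -> Defs.span S y -> Defs.span S (x + y).
Proof.
move=> hx hy; elim: hx => [|c u v Su _ IH]; first by rewrite add0r.
by rewrite -addrA; apply: Defs.span_cons.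
Qed.

Lemma spanZ S c x : Defs.span S x -> Defs.span S (c *: x).
Proof.
elim=> [|d u v Su _ IH]; first by rewrite scaler0; apply: Defs.span0.
by rewrite scalerDr scalerA; apply: Defs.span_cons.
Qed.

Lemma span_sum S (I : eqType) (r : seq I) (p : pred I) (F : I -> M) :
  (forall i, i \in r -> p i -> Defs.span S (F i)) ->
  Defs.span S (\sum_(i <- r | p i) F i).
Proof.
move=> h; rewrite big_seq_cond.
by elim/big_rec: _ => [|i x /andP[ir pi] IH]; [apply: Defs.span0|apply: spanD => //; apply: h].
Qed.

Lemma span_mono S S' : (forall x, S x -> S' x) ->
  forall x, Defs.span S x -> Defs.span S' x.
Proof.
move=> h x; elim=> [|c u v Su _ IH]; first exact: Defs.span0.
by apply: Defs.span_cons => //; apply: h.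
Qed.

End Span.

Section Support.
Variables (K : fieldType) (X : choiceType).
Implicit Types (p : pred X) (u : {malg K[X]}).

Definition suppin_pred p : {pred {malg K[X]}} := fun u => all p (msupp u).

Lemma suppinP p u : reflect (forall x, u@_x != 0 -> p x) (u \in suppin_pred p).
Proof.
apply: (iffP allP) => h x; first by rewrite mcoeff_neq0; apply: h.
by rewrite -mcoeff_neq0; apply: h.
Qed.

Lemma suppin_closed p : submod_closed (suppin_pred p).
Proof.
split; first by apply/suppinP => x; rewrite mcoeff0 eqxx.
move=> c u v /suppinP hu /suppinP hv; apply/suppinP => x.
rewrite mcoeffD mcoeffZ; case: (eqVneq u@_x 0) => [->|/hu //].
by rewrite mulr0 add0r; apply: hv.
Qed.

HB.instance Definition _ p :=
  GRing.isSubmodClosed.Build K {malg K[X]} (suppin_pred p) (suppin_closed p).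

Definition suppin p : submodClosed {malg K[X]} := suppin_pred p.

Lemma in_suppinU p x : (<< x >> \in suppin p) = p x.
Proof.
apply/suppinP/idP => [/(_ x)|px y].
  by rewrite mcoeffUU oner_neq0; apply.
by rewrite mcoeffU; case: (x =P y) => [<- //|_]; rewrite mulr0n eqxx.
Qed.

Lemma suppin_span p u : u \in suppin p <->
  Defs.span (fun v => exists x, p x /\ v = << x >>) u.
Proof.
split=> [/allP h|]; last first.
  elim=> [|c v w [x [px ->]] _ IH]; first exact: rpred0.
  by rewrite rpredD ?rpredZ ?in_suppinU.
rewrite [u]malg_sumE; apply: span_sum => x xu _.
by apply/spanZ/span_gen; exists x; split; first exact: h.
Qed.

Lemma malgU_free (I : choiceType) (v : I -> X) (F : {fset I}) (c : I -> K) :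
  injective v -> \sum_(i <- F) c i *: (<< v i >> : {malg K[X]}) = 0 ->
  forall i, i \in F -> c i = 0.
Proof.
move=> vi s0 i iF; have := congr1 (mcoeff (v i)) s0.
rewrite mcoeff0 raddf_sum /= (big_rem i) //= mcoeffZ mcoeffUU mulr1.
rewrite big_seq big1 ?addr0 // => j.
rewrite mem_rem_uniq ?fset_uniq // inE => /andP[ji _].
by rewrite mcoeffZ mcoeffU (inj_eq vi) (negPf ji) mulr0n mulr0.
Qed.

(** A partition of part of a basis, given by the fibres of a labelling, makes
    the span of that part a direct sum. *)
Lemma direct_sum_label (I : choiceType) (l : X -> I) p
    (W : I -> {malg K[X]} -> Prop) (U : {malg K[X]} -> Prop) :
  (forall i u, W i u <-> u \in suppin (fun x => p x && (l x == i))) ->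
  (forall u, U u <-> u \in suppin p) ->
  direct_sum W U.
Proof.
move=> hW hU; split.
- move=> i u /hW/suppinP h; apply/hU/suppinP => x ux.
  by have /andP[] := h x ux.
- move=> u /hU/suppinP h.
  exists [fset l x | x in msupp u]%fset.
  exists (fun i => \sum_(x <- msupp u | l x == i) u@_x *: << x >>); split.
    move=> i; apply/hW; rewrite big_seq_cond; apply: rpred_sum => x /andP[xu lx].
    by rewrite rpredZ // in_suppinU lx andbT h // mcoeff_neq0.
  rewrite (exchange_big_dep xpredT) //= {1}[u]malg_sumE big_seq [RHS]big_seq.
  apply: eq_bigr => x xu.
  rewrite (big_rem (l x)) /=; last by apply/imfsetP; exists x.
  rewrite eqxx big_seq_cond big1 ?addr0 // => i /andP[ir /eqP li].
  by move: ir; rewrite -li mem_rem_uniq ?fset_uniq // inE eqxx.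
- move=> F f hf s0 i iF; apply/malgP => x; rewrite mcoeff0.
  have /hW/suppinP hi := hf i.
  case: (eqVneq (f i)@_x 0) => // /[dup] fx /hi/andP[_ /eqP lx].
  have := congr1 (mcoeff x) s0; rewrite mcoeff0 raddf_sum /= (big_rem i) //=.
  rewrite big_seq big1 ?addr0 // => j.
  rewrite mem_rem_uniq ?fset_uniq // inE => /andP[/negPf ji _].
  have /hW/suppinP hj := hf j.
  by case: (eqVneq (f j)@_x 0) => // /hj/andP[_]; rewrite lx eq_sym ji.
Qed.

End Support.

Arguments suppin {K X} p.

(** * Zigzag connectedness and contractible equivalences *)

Lemma connect_min (T : finType) (e r : rel T) :
  reflexive r -> transitive r -> subrel e r -> subrel (connect e) r.
Proof.
move=> rr tr er x y /connectP[p pp ->] {y}.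
elim: p x pp => //= z p IH x /andP[/er xz /IH]; exact: tr.
Qed.

Section ZigZag.
Variable T : finType.
Implicit Types P E F : qposet T.

Lemma equivP E : reflect (symmetric E) (is_equiv E).
Proof.
apply: (iffP forallP) => [h x y|h x].
  by apply/idP/idP; move: (h x) (h y) => /forallP/(_ y)/implyP + /forallP/(_ x)/implyP.
by apply/forallP => y; rewrite h implybb.
Qed.

(** The equivalence of being in the same connected component, as a symmetric
    quasi-poset, so that it can itself be used as a contraction. *)
Definition zz P : qposet T :=
  qposet_of
    (@connect0 _ [rel x y | P x y || P y x] : reflexive (connect _))
    (@connect_trans _ [rel x y | P x y || P y x] : transitive (connect _)).

Lemma zz_min P (r : rel T) : reflexive r -> symmetric r -> transitive r ->
  subrel P r -> subrel (zz P) r.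
Proof.
move=> rr sr tr Pr x y; rewrite qposet_ofE; apply: connect_min => // a b /=.
by case/orP => /Pr; rewrite // sr.
Qed.

Lemma sub_zz P : subrel P (zz P).
Proof. by move=> x y xy; rewrite qposet_ofE connect1 //= xy. Qed.

Lemma zz_sym P : symmetric (zz P).
Proof.
by move=> x y; rewrite !qposet_ofE; apply: sym_connect_sym => a b /=; rewrite orbC.
Qed.

Lemma zz_mono P E : subrel P E -> subrel (zz P) (zz E).
Proof.
move=> PE; apply: zz_min; [exact: qrefl|exact: zz_sym|exact: qtrans|].
by move=> x y /PE; apply: sub_zz.
Qed.

Lemma zz_equiv_sub P E : symmetric E -> subrel P E -> subrel (zz P) E.
Proof. by move=> sE; apply: zz_min => //; [exact: qrefl|exact: qtrans]. Qed.

Lemma qconnectedP P : reflect (forall x y : T, zz P x y) (qconnected P).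
Proof.
apply: (iffP forallP) => [h x y|h O].
  have /implyP := h [set y | zz P x y].
  have zo : [set y | zz P x y] \in qtop P.
    rewrite inE; apply/forallP => i; apply/forallP => j; rewrite !inE.
    by apply/implyP => /andP[xi /sub_zz]; apply: qtrans.
  have zc : ~: [set y | zz P x y] \in qtop P.
    rewrite inE; apply/forallP => i; apply/forallP => j; rewrite !inE.
    apply/implyP => /andP[xi /sub_zz ij]; apply: contraNN xi => xj.
    by rewrite zz_sym in ij; apply: qtrans xj ij.
  rewrite zo zc => /(_ isT)/orP[] /eqP/setP; last first.
    by move=> /(_ y); rewrite !inE.
  by move=> /(_ x); rewrite !inE qrefl.
apply/implyP; rewrite !inE => /andP[/forallP o1 /forallP o2].
case: (set_0Vmem O) => [->|[x xO]]; first by rewrite eqxx.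
apply/orP; right; apply/eqP/setP => y; rewrite inE.
have /eqP <- // : (x \in O) == (y \in O).
  apply: (zz_min (r := fun a b => (a \in O) == (b \in O))) (h x y).
  - by [].
  - by move=> a b; rewrite eq_sym.
  - by move=> a b c /eqP-> /eqP->.
  move=> a b ab; move: (o1 a) (o2 a) => /forallP/(_ b) + /forallP/(_ b).
  by rewrite ab !inE !andbT; case: (a \in O) (b \in O) => [] [].
Qed.

End ZigZag.

Section Contraction.
Variable T : finType.
Implicit Types P E F : qposet T.

(** A clopen set of a class of [E] is stable under the steps of [P|E], and
    these steps never leave a class. *)
Lemma qconnected_classesP P E : symmetric E ->
  reflect (subrel E (zz (qres P E)))
          [forall x, qconnected (qrestr P [set y | E x y])].
Proof.
move=> sE; apply: (iffP forallP) => [h x y xy|h x].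
  have /qconnectedP c := h x.
  have xB : x \in [set y | E x y] by rewrite inE qrefl.
  have yB : y \in [set y | E x y] by rewrite inE.
  pose r := relpre (val : {z | z \in [set y | E x y]} -> T) (zz (qres P E)).
  apply: (zz_min (r := r)) (c (Sub x xB) (Sub y yB)).
  - by move=> a; apply: qrefl.
  - by move=> a b; apply: zz_sym.
  - by move=> a b d; apply: qtrans.
  move=> [a aB] [b bB]; rewrite qpullE /r /= => ab; apply: sub_zz.
  rewrite qposet_ofE ab /=; rewrite !inE in aB bB.
  by apply: qtrans bB; rewrite sE.
apply/forallP => O; apply/implyP; rewrite !inE => /andP[/forallP o1 /forallP o2].
case: (set_0Vmem O) => [->|[a aO]]; first by rewrite eqxx.
apply/orP; right; apply/eqP/setP => b; rewrite inE.
have Eab : E (val a) (val b).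
  move: (valP a) (valP b); rewrite !inE => ha hb.
  by apply: qtrans hb; rewrite sE.
have nB w : w \notin [set y | E x y] -> (w \in val @: O) = false.
  move=> wB; apply/imsetP => -[d _ wd]; move: wB; rewrite wd.
  by rewrite (valP d).
rewrite -(mem_imset O _ val_inj); have : val a \in val @: O by rewrite imset_f.
have /eqP -> // : (val a \in val @: O) == (val b \in val @: O).
apply: (zz_min (r := fun u v => (u \in val @: O) == (v \in val @: O))) (h _ _ Eab).
- by [].
- by move=> u v; rewrite eq_sym.
- by move=> u v w /eqP-> /eqP->.
move=> u v; rewrite qposet_ofE => /andP[uv Euv].
have uvB : (u \in [set y | E x y]) = (v \in [set y | E x y]).
  rewrite !inE; apply/idP/idP => xu; first exact: qtrans xu Euv.
  by rewrite sE in Euv; apply: qtrans xu Euv.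
case: (boolP (u \in [set y | E x y])) => [uB|uB]; last by rewrite !nB // -uvB.
have vB : v \in [set y | E x y] by rewrite -uvB.
have -> : u = val (Sub u uB : {z | z \in [set y | E x y]}) by [].
have -> : v = val (Sub v vB : {z | z \in [set y | E x y]}) by [].
rewrite !(mem_imset O _ val_inj).
move: (o1 (Sub u uB)) (o2 (Sub u uB)) => /forallP/(_ (Sub v vB)) + /forallP/(_ (Sub v vB)).
rewrite !qpullE /= uv !inE !andbT.
by case: (_ \in O) (_ \in O) => [] [].
Qed.

Lemma qquo_l P E : subrel P (qquo P E).
Proof. by move=> x y xy; rewrite qposet_ofE; apply: connect1; rewrite /= xy. Qed.

Lemma qquo_r P E : subrel E (qquo P E).
Proof.
by move=> x y xy; rewrite qposet_ofE; apply: connect1; rewrite /= xy orbT.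
Qed.

Lemma qquo_min P E F : subrel P F -> subrel E F -> subrel (qquo P E) F.
Proof.
move=> PF EF x y; rewrite qposet_ofE.
apply: connect_min; [exact: qrefl|exact: qtrans|].
by move=> a b /orP[/PF|/EF].
Qed.

Lemma qresE P E x y : qres P E x y = P x y && E x y.
Proof. exact: qposet_ofE. Qed.

Lemma qres_l P E : subrel (qres P E) P.
Proof. by move=> x y; rewrite qresE => /andP[]. Qed.

Lemma qres_r P E : subrel (qres P E) E.
Proof. by move=> x y; rewrite qresE => /andP[]. Qed.

Lemma zz_res_sub P E : symmetric E -> subrel (zz (qres P E)) E.
Proof. by move=> sE; apply: zz_equiv_sub => //; apply: qres_r. Qed.

(** The inclusion of [E] in the equivalence of [P/E] is automatic, so one
    inclusion expresses each of the two conditions on [E]. *)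
Lemma triangleP E P : reflect
  [/\ symmetric E, subrel E (zz (qres P E)) & subrel (qsim (qquo P E)) E]
  (triangle E P).
Proof.
have sim_r : symmetric E -> subrel E (qsim (qquo P E)).
  by move=> sE x y xy; rewrite /qsim !qquo_r // sE.
apply: (iffP and3P) => -[].
  move=> /equivP sE /(qconnected_classesP P sE) c /forallP h; split=> // x y.
  by have /forallP/(_ y)/eqP -> := h x.
move=> sE c h; split; first exact/equivP.
  exact/(qconnected_classesP P sE).
apply/forallP => x; apply/forallP => y; apply/eqP; apply/idP/idP; first exact: h.
exact: sim_r.
Qed.

Lemma triangle_sim E P x y : triangle E P -> qsim (qquo P E) x y = E x y.
Proof. by case/and3P => _ _ /forallP/(_ x)/forallP/(_ y)/eqP. Qed.

Lemma qquo_qquo P E F : subrel E F -> qquo (qquo P E) F = qquo P F.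
Proof.
move=> EF; apply: qposetP => x y; apply/idP/idP; apply: qquo_min.
- apply: qquo_min; first exact: qquo_l.
  by move=> a b /EF; apply: qquo_r.
- exact: qquo_r.
- by move=> a b /(@qquo_l _ E); apply: qquo_l.
- exact: qquo_r.
Qed.

Lemma qres_qres P E F : subrel E F -> qres (qres P F) E = qres P E.
Proof.
move=> EF; apply: qposetP => x y; rewrite !qresE -andbA.
by case: (boolP (E x y)) => [/EF->|]; rewrite ?andbF.
Qed.

(** A path of the quotient [P / E] whose ends lie in the same class of [F]
    stays in that class, since all its vertices are equivalent modulo [F]. *)
Lemma qres_qquo P E F : symmetric F -> subrel E F ->
  subrel (qsim (qquo P F)) F -> qres (qquo P E) F = qquo (qres P F) E.
Proof.
move=> sF EF simF; apply: qposetP => x y; rewrite qresE; apply/idP/idP.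
  case/andP; rewrite [qquo P E x y]qposet_ofE => /connectP[p].
  elim: p x => [x _ -> _|z p IH x /= /andP[xz zp] ly Fxy]; first exact: qrefl.
  have Fxz : F x z.
    apply: simF; rewrite /qsim; apply/andP; split.
      by case/orP: xz => [/(@qquo_l _ F)|/EF/(@qquo_r P)].
    have zy : qquo P F z y.
      rewrite -(qquo_qquo P EF); apply: qquo_l.
      by rewrite [qquo P E z y]qposet_ofE; apply/connectP; exists p.
    by apply: qtrans zy _; apply: qquo_r; rewrite sF.
  apply: (qtrans (y := z)); last by apply: IH => //; apply: qtrans Fxy; rewrite sF.
  case/orP: xz => [xz|Exz]; last exact: qquo_r.
  by apply: qquo_l; rewrite qresE xz.
move=> h; apply/andP; split; move: h; apply: qquo_min.
- by move=> a b /qres_l; apply: qquo_l.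
- exact: qquo_r.
- exact: qres_r.
- exact: EF.
Qed.

Lemma triangle_quo_sub P E F : triangle E P -> triangle F (qquo P E) ->
  subrel E F.
Proof.
case/triangleP => sE _ _ /triangleP[_ _ simF] x y xy; apply: simF.
by rewrite /qsim; apply/andP; split; apply/qquo_l/qquo_r; rewrite // sE.
Qed.

Lemma triangle_res_sub P E F : symmetric F -> triangle E (qres P F) ->
  subrel E F.
Proof.
move=> sF /triangleP[sE cE _] x y /cE; apply: zz_equiv_sub => // a b /qres_l.
exact: qres_r.
Qed.

(** Contracting [E] and then [F] is the same as choosing [F] and then refining
    it by [E]: this exchange is the coassociativity of [delta]. *)
Lemma triangle_exchange P E F :
  triangle E P && triangle F (qquo P E) =
  triangle F P && triangle E (qres P F).
Proof.
apply/andP/andP => -[].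
  move=> tE tF; have EF := triangle_quo_sub tE tF.
  move: tE tF => /triangleP[sE cE simE] /triangleP[sF cF simF].
  rewrite (qquo_qquo P EF) in simF.
  have tF : triangle F P.
    apply/triangleP; split => // x y /cF.
    rewrite (qres_qquo sF EF simF); apply: zz_min; last apply: qquo_min.
    - exact: qrefl.
    - exact: zz_sym.
    - exact: qtrans.
    - exact: sub_zz.
    - by move=> a b /cE; rewrite -(qres_qres P EF); apply/zz_mono/qres_l.
  split=> //; apply/triangleP; split => //.
    by move=> x y /cE; rewrite (qres_qres P EF).
  move=> x y /andP[xy yx]; apply: simE.
  by move: xy yx; rewrite -(qres_qquo sF EF simF) !qresE /qsim => /andP[-> _] /andP[-> _].
move=> /triangleP[sF cF simF] tE; have EF := triangle_res_sub sF tE.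
move: tE => /triangleP[sE cE simE].
have simE' : subrel (qsim (qquo P E)) E.
  move=> x y /andP[xy yx].
  have Fxy : F x y.
    by apply: simF; rewrite /qsim -(qquo_qquo P EF); apply/andP; split; apply: qquo_l.
  have Fyx : F y x by rewrite sF.
  by apply: simE; rewrite /qsim -(qres_qquo sF EF simF) !qresE xy yx Fxy.
split; apply/triangleP; split => //.
- by move=> x y /cE; rewrite (qres_qres P EF).
- move=> x y /cF; apply: zz_mono => a b; rewrite !qresE => /andP[/(@qquo_l _ E)-> ].
  by [].
- by rewrite (qquo_qquo P EF).
Qed.

Lemma zz_triangle P : triangle (zz P) P.
Proof.
have e : qres P (zz P) = P.
  apply: qposetP => x y; rewrite qresE.
  by case: (boolP (P x y)) => [/sub_zz->|].
apply/triangleP; split; [exact: zz_sym|by rewrite e|].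
by move=> x y /andP[+ _]; apply: qquo_min => //; apply: sub_zz.
Qed.

(** The equivalence [~P], the finest contraction of [P]. *)
Definition qcore P : qposet T :=
  qposet_of (fun x => introT andP (conj (qrefl P x) (qrefl P x)) : qsim P x x)
    (fun y x z (xy : qsim P x y) (yz : qsim P y z) =>
       let: conj xy yx := elimT andP xy in let: conj yz zy := elimT andP yz in
       introT andP (conj (qtrans xy yz) (qtrans zy yx)) : qsim P x z).

Lemma qcoreE P x y : qcore P x y = qsim P x y.
Proof. exact: qposet_ofE. Qed.

Lemma qcore_sym P : symmetric (qcore P).
Proof. by move=> x y; rewrite !qcoreE /qsim andbC. Qed.

Lemma qcore_sub P : subrel (qcore P) P.
Proof. by move=> x y; rewrite qcoreE => /andP[]. Qed.

Lemma qres_core P : qres P (qcore P) = qcore P.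
Proof.
apply: qposetP => x y; rewrite qresE.
by case: (boolP (qcore P x y)) => [/qcore_sub->|]; rewrite ?andbF.
Qed.

Lemma qquo_core P : qquo P (qcore P) = P.
Proof.
apply: qposetP => x y; apply/idP/idP; last exact: qquo_l.
by apply: qquo_min => //; apply: qcore_sub.
Qed.

Lemma core_triangle P : triangle (qcore P) P.
Proof.
apply/triangleP; split; first exact: qcore_sym.
  by rewrite qres_core; apply: sub_zz.
by move=> x y; rewrite qquo_core qcoreE.
Qed.

Lemma triangle_core_sub P E : triangle E P -> subrel (qcore P) E.
Proof.
case/triangleP => _ _ h x y; rewrite qcoreE => /andP[xy yx]; apply: h.
by rewrite /qsim !qquo_l.
Qed.

Lemma triangle_zz_sub P E : triangle E P -> subrel E (zz P).
Proof. by case/triangleP => _ c _ x y /c; apply/zz_mono/qres_l. Qed.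

Lemma qdiscreteP P : reflect (symmetric P) (qdiscrete P).
Proof.
apply: (iffP forallP) => [h x y|h x].
  have := h x; have := h y => /forallP/(_ x)/eqP hy /forallP/(_ y)/eqP hx.
  by rewrite hx hy /qsim andbC.
by apply/forallP => y; rewrite /qsim [P y x]h andbb.
Qed.

Lemma qres_zz P : qres P (zz P) = P.
Proof.
apply: qposetP => x y; rewrite qresE.
by case: (boolP (P x y)) => [/sub_zz->|].
Qed.

(** [P/E] is discrete when [P] is contained in [E], which forces [E] to contain
    all of [zz P]. *)
Lemma qquo_discrete P E : triangle E P ->
  qdiscrete (qquo P E) = (E == zz P).
Proof.
move=> tE; apply/idP/eqP => [/qdiscreteP s|->].
  apply: qposetP => x y; apply/idP/idP; first exact: triangle_zz_sub.
  have [sE _ h] := triangleP _ _ tE; apply: zz_equiv_sub => // a b ab.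
  have qab : qquo P E a b by apply: qquo_l.
  by apply: h; rewrite /qsim qab s qab.
apply/qdiscreteP => x y.
have e u v : qquo P (zz P) u v = zz P u v.
  apply/idP/idP; last exact: qquo_r.
  by apply: qquo_min => //; apply: sub_zz.
by rewrite !e zz_sym.
Qed.

(** [P|E] is discrete when its zigzags reduce to [~P], while [E] is made of
    these zigzags. *)
Lemma qres_discrete P E : triangle E P ->
  qdiscrete (qres P E) = (E == qcore P).
Proof.
move=> tE; apply/idP/eqP => [/qdiscreteP s|->]; last first.
  by rewrite qres_core; apply/qdiscreteP/qcore_sym.
apply: qposetP => x y; apply/idP/idP; last exact: triangle_core_sub.
have [sE c _] := triangleP _ _ tE; move=> /c; apply: zz_equiv_sub.
  exact: qcore_sym.
move=> a b ab; rewrite qcoreE /qsim (qres_l ab).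
by rewrite s in ab; rewrite (qres_l ab).
Qed.

End Contraction.

(** * Isoclasses of restrictions and numbers of classes *)

Definition rclass (T : finType) (P : qposet T) (B : {set T}) : qp :=
  qclass (qrestr P B).

Section Restriction.
Variable T : finType.
Implicit Types (P E : qposet T) (B O : {set T}).


(** The isoclass of a pullback along an injection only depends on the image of
    the injection, which makes all iterated restrictions comparable. *)
Lemma qclass_pull_inj (U : finType) (f : U -> T) P :
  injective f -> qclass (qpull f P) = rclass P [set f x | x : U].
Proof.
move=> fi; apply/qclassP.
have fB x : f x \in [set f x | x : U] by apply: imset_f.
exists (fun x => (Sub (f x) (fB x) : {y : T | y \in [set f x | x : U]})).
  apply: inj_card_bij => [x y /(congr1 val) /= /fi //|].
  by rewrite card_sig card_imset.
by move=> x y; rewrite !qpullE.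
Qed.

Lemma rclassT P : rclass P setT = qclass P.
Proof.
have -> : [set: T] = [set id x | x : T].
  by apply/setP => x; rewrite inE; apply/esym/imsetP; exists x.
rewrite -qclass_pull_inj //; congr qclass.
by apply: qposetP => x y; rewrite qpullE.
Qed.

Lemma rclass_pull (U : finType) (f : U -> T) P (C : {set U}) :
  injective f -> rclass (qpull f P) C = rclass P (f @: C).
Proof.
move=> fi.
have -> : rclass (qpull f P) C =
    qclass (qpull (f \o (val : {x | x \in C} -> U)) P).
  by congr qclass; apply: qposetP => x y; rewrite !qpullE.
rewrite qclass_pull_inj; last exact: inj_comp fi val_inj.
congr rclass; apply/setP => y; apply/imsetP/imsetP => -[x].
  by move=> _ ->; exists (val x) => //; exact: (valP x).
by move=> xC ->; exists (Sub x xC).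
Qed.

Lemma rclass_restr P B (C : {set {x | x \in B}}) :
  rclass (qrestr P B) C = rclass P (val @: C).
Proof. exact: rclass_pull val_inj. Qed.

Lemma rclass0 P : rclass P set0 = qp_one.
Proof.
by apply/eqP; rewrite qclass_eq1 card_sig; apply/eqP/eq_card0 => x; rewrite inE.
Qed.

Lemma rclass_eq1 P B : (rclass P B == qp_one) = (B == set0).
Proof. by rewrite qclass_eq1 card_sig -cards_eq0. Qed.

End Restriction.

Section NumberOfClasses.
Variable T : finType.
Implicit Types (P E : qposet T) (B O : {set T}).

Definition qcell P x := [set y | qsim P x y].

Lemma qsim_sym P : symmetric (qsim P).
Proof. by move=> x y; rewrite /qsim andbC. Qed.

Lemma qsim_trans P : transitive (qsim P).
Proof. by move=> y x z; rewrite -!qcoreE; apply: qtrans. Qed.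

Lemma qsim_refl P : reflexive (qsim P).
Proof. by move=> x; rewrite /qsim qrefl. Qed.

Lemma eq_qcell P x y : (qcell P x == qcell P y) = qsim P x y.
Proof.
apply/eqP/idP => [/setP/(_ y)|xy]; first by rewrite !inE qsim_refl => ->.
apply/setP => z; rewrite !inE; apply/idP/idP; apply: qsim_trans => //.
by rewrite qsim_sym.
Qed.

Lemma cl_pull_image (U : finType) (f : U -> T) P :
  cl (qpull f P) = #|[set qcell P (f x) | x : U]|.
Proof.
rewrite /cl -(card_in_imset (f := fun B : {set T} => f @^-1: B)).
  congr #|pred_of_set _|; rewrite -imset_comp; apply: eq_imset => x /=.
  by apply/setP => y; rewrite !inE /qsim !qpullE.
move=> _ _ /imsetP[x _ ->] /imsetP[y _ ->] /setP/(_ x).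
by rewrite !inE qsim_refl => /esym; rewrite qsim_sym -eq_qcell => /eqP.
Qed.

Lemma cl_restr P B : cl (qrestr P B) = #|qcell P @: B|.
Proof.
rewrite cl_pull_image; congr #|pred_of_set _|.
apply/setP => C; apply/imsetP/imsetP => -[x].
  by move=> _ ->; exists (val x) => //; exact: (valP x).
by move=> xB ->; exists (Sub x xB).
Qed.

Lemma clE P : cl P = #|qcell P @: [set: T]|.
Proof.
congr #|pred_of_set _|; apply/setP => C.
by apply/imsetP/imsetP => -[x _ ->]; exists x.
Qed.

Lemma cl_split P B : (forall x y, qsim P x y -> (x \in B) = (y \in B)) ->
  cl P = (cl (qrestr P (~: B)) + cl (qrestr P B))%N.
Proof.
move=> h; rewrite clE !cl_restr -(setUCr B) imsetU [RHS]addnC -cardsUI.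
rewrite [X in (_ + X)%N](_ : _ = 0%N) ?addn0 //.
apply/eqP; rewrite cards_eq0 -subset0; apply/subsetP => C.
rewrite inE => /andP[/imsetP[x xB ->] /imsetP[y yB /eqP]].
by rewrite eq_qcell => /h; rewrite xB; move: yB; rewrite inE => /negPf->.
Qed.

Lemma cl_eq0 P : (cl P == 0%N) = (#|T| == 0%N).
Proof. by rewrite clE cards_eq0 imset_eq0 -cards_eq0 cardsT. Qed.

Lemma cl_total P : (forall x y, P x y) -> (0 < #|T|)%N -> cl P = 1%N.
Proof.
move=> h; rewrite clE => /card_gt0P[x _]; rewrite (_ : _ @: _ = [set qcell P x]).
  by rewrite cards1.
apply/setP => C; rewrite inE; apply/imsetP/eqP => [[y _ ->]|->]; last by exists x.
by apply/eqP; rewrite eq_qcell /qsim !h.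
Qed.

Lemma cl1_total P : cl P = 1%N -> forall x y, P x y.
Proof.
rewrite clE => /eqP/cards1P[C eC] x y.
have := imset_f (qcell P) (in_setT x); have := imset_f (qcell P) (in_setT y).
rewrite eC !inE => /eqP <-; rewrite eq_qcell => /andP[].
by [].
Qed.

Lemma qcell_mono P E : subrel (qsim P) (qsim E) ->
  qcell E @: [set: T] =
  (fun C : {set T} => \bigcup_(z in C) qcell E z) @: (qcell P @: [set: T]).
Proof.
move=> h; rewrite -imset_comp; apply: eq_imset => x /=.
apply/setP => y; apply/idP/bigcupP => [xy|[z]].
  by exists x; rewrite // inE qsim_refl.
by rewrite !inE => /h; apply: qsim_trans.
Qed.

Lemma cl_mono P E : subrel (qsim P) (qsim E) -> (cl E <= cl P)%N.
Proof. by move=> /qcell_mono h; rewrite !clE h leq_imset_card. Qed.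

(** The cells of [E] are unions of cells of [P]; two cells of [P] with the same
    union make the count drop. *)
Lemma cl_mono_lt P E x y : subrel (qsim P) (qsim E) ->
  qsim E x y -> ~~ qsim P x y -> (cl E < cl P)%N.
Proof.
move=> h exy pxy; rewrite ltn_neqAle cl_mono // andbT.
apply: contra pxy; rewrite !clE (qcell_mono h) => /imset_injP hi.
rewrite -eq_qcell; apply/eqP/hi; rewrite ?imset_f //.
have im z : \bigcup_(w in qcell P z) qcell E w = qcell E z.
  apply/setP => w; apply/bigcupP/idP => [[v]|zw].
    by rewrite !inE => /h; apply: qsim_trans.
  by exists z; rewrite // inE qsim_refl.
by rewrite !im; apply/eqP; rewrite eq_qcell.
Qed.

Lemma eq_cl P E : (forall x y, qsim P x y = qsim E x y) -> cl P = cl E.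
Proof.
move=> h; rewrite !clE; congr #|pred_of_set _|; apply: eq_imset => x.
by apply/setP => y; rewrite !inE h.
Qed.

End NumberOfClasses.

(** * The coproduct of open sets *)

Section Glue.
Variables (T : finType) (B : {set T}).

Definition glue (a : {x | x \in ~: B} + {x | x \in B}) : T :=
  match a with inl x => val x | inr x => val x end.

Lemma glue_bij : bijective glue.
Proof.
apply: inj_card_bij => [|].
  move=> [a|a] [b|b] /= e.
  - by congr inl; apply: val_inj.
  - by move: (valP a) (valP b); rewrite /= e inE => /negP.
  - by move: (valP b) (valP a); rewrite /= -e inE => /negP.
  - by congr inr; apply: val_inj.
by rewrite card_sum !card_sig addnC cardsC.
Qed.

(** A quasi-poset without relations between [B] and its complement is the
    disjoint union of its restrictions. *)
Lemma rclass_split (P : qposet T) :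
  (forall x y, P x y -> (x \in B) = (y \in B)) ->
  qclass P = qp_mul (rclass P (~: B)) (rclass P B).
Proof.
move=> h; rewrite qp_mulE; apply/esym/qclassP.
exists glue; first exact: glue_bij.
move=> [a|a] [b|b]; rewrite qposet_ofE /= ?qpullE //=; apply/negP => /h.
  by rewrite (valP b); have := valP a; rewrite inE => /negPf->.
by rewrite (valP a); have := valP b; rewrite inE => /negPf->.
Qed.

End Glue.

Lemma qtopP (T : finType) (P : qposet T) (O : {set T}) :
  reflect (forall i j, i \in O -> P i j -> j \in O) (O \in qtop P).
Proof.
rewrite inE; apply: (iffP forallP) => [h i j iO ij|h i].
  by have /forallP/(_ j)/implyP := h i; apply; rewrite iO.
by apply/forallP => j; apply/implyP => /andP[]; apply: h.
Qed.

Section OpenSets.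
Variable T : finType.
Implicit Types (P E : qposet T) (A B C O : {set T}).

Lemma val_setC B (C : {set {x | x \in B}}) :
  B :\: val @: C = val @: ~: C.
Proof.
apply/setP => x; rewrite inE; apply/esym; apply/imsetP/andP => [[a aC ->]|[nx xB]].
  by rewrite mem_imset ?(valP a) //; [rewrite inE in aC|exact: val_inj].
by exists (Sub x xB) => //; rewrite inE -(mem_imset _ _ val_inj).
Qed.

Lemma rclass_setU P A B : [disjoint A & B] ->
  (forall x y, x \in A -> y \in B -> ~~ P x y && ~~ P y x) ->
  rclass P (A :|: B) = qp_mul (rclass P A) (rclass P B).
Proof.
move=> dAB h; pose C := [set x : {x | x \in A :|: B} | val x \in B].
have vC : val @: C = B.
  apply/setP => x; apply/imsetP/idP => [[a + ->]|xB]; first by rewrite inE.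
  have xAB : x \in A :|: B by rewrite inE xB orbT.
  by exists (Sub x xAB); rewrite // inE.
rewrite [LHS](@rclass_split _ C); last first.
  move=> [x xAB] [y yAB]; rewrite qpullE /= !inE /= => xy.
  move: (xAB) (yAB) (h x y) (h y x); rewrite !inE xy !andbF !andFb.
  by case: (x \in A) (x \in B) (y \in A) (y \in B) => [] [] [] [] //= _ _ h1 h2;
    by first [move: (h1 isT isT) | move: (h2 isT isT)].
rewrite !rclass_restr -val_setC vC; congr (qp_mul (rclass P _) _).
apply/setP => x; rewrite !inE; case: (boolP (x \in B)) => [xB|]; last by rewrite orbF.
by rewrite /= (disjointFl dAB xB).
Qed.

Definition opens P B : pred {set T} := fun A =>
  (A \subset B) && [forall i in A, forall j in B, P i j ==> (j \in A)].

Lemma opensP P B A : reflect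
  (A \subset B /\ forall i j, i \in A -> j \in B -> P i j -> j \in A)
  (opens P B A).
Proof.
apply: (iffP andP) => -[AB h]; split=> //.
  by move=> i j iA jB; move/forall_inP/(_ i iA)/forall_inP/(_ j jB)/implyP: h.
apply/forall_inP => i iA; apply/forall_inP => j jB; apply/implyP; exact: h.
Qed.

Lemma sum_opens (M : nmodType) P B (F : {set T} -> M) :
  \sum_(C in qtop (qrestr P B)) F (val @: C) = \sum_(A | opens P B A) F A.
Proof.
rewrite [RHS](reindex_onto (fun C : {set {x | x \in B}} => val @: C)
                    (fun A => val @^-1: A)) /=; last first.
  move=> A /opensP[/subsetP AB _]; apply/setP => x; apply/imsetP/idP.
    by move=> [a + ->]; rewrite inE.
  by move=> xA; exists (Sub x (AB x xA)); rewrite // inE.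
apply: eq_bigl => C; rewrite (_ : val @^-1: _ = C) ?eqxx ?andbT; last first.
  by apply/setP => x; rewrite inE (mem_imset _ _ val_inj).
apply/qtopP/opensP => [h|[_ h] i j iC].
  split; first by apply/subsetP => x /imsetP[a _ ->]; exact: (valP a).
  move=> _ j /imsetP[a aC ->] jB aj; apply/imsetP; exists (Sub j jB) => //.
  by apply: h aC _; rewrite qpullE.
rewrite qpullE => ij; rewrite -(mem_imset C j val_inj).
by apply: h ij; rewrite ?imset_f //; exact: (valP j).
Qed.

Lemma qtop0 P : set0 \in qtop P.
Proof. by apply/qtopP => i j; rewrite inE. Qed.

Lemma qtopT P : setT \in qtop P.
Proof. by apply/qtopP => i j; rewrite !inE. Qed.

(** Both double sums of coassociativity range over the chains [A \subset B] of
    open sets. *)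
Lemma sum_open_chains (M : nmodType) P (F : {set T} -> {set T} -> {set T} -> M) :
  \sum_(O in qtop P) \sum_(C | opens P (~: O) C) F (~: O :\: C) C O =
  \sum_(O in qtop P) \sum_(A | opens P O A) F (~: O) (O :\: A) A.
Proof.
rewrite [RHS](exchange_big_dep (fun A => A \in qtop P)) /=; last first.
  move=> O A /qtopP oO /opensP[/subsetP AO h]; apply/qtopP => i j iA ij.
  by apply: (h _ _ iA _ ij); apply: (oO _ _ (AO _ iA) ij).
apply: eq_bigr => A oA; have /qtopP hA := oA.
rewrite (reindex_onto (fun B => B :\: A) (fun C => C :|: A)) /=; last first.
  move=> C /opensP[CA _]; apply/setP => x; rewrite !inE.
  by have /subsetP/(_ x) := CA; rewrite inE; case: (x \in A) (x \in C) => [] [] // /(_ isT).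
apply: eq_big => [B|B /andP[_ /eqP e]]; last first.
  congr (F _ _ _); apply/setP => x; rewrite -[in RHS]e !inE.
  by case: (x \in A) (x \in B) => [] [].
apply/andP/andP => [[/opensP[_ h] /eqP e]|[oB /opensP[AB h]]].
  have AB : A \subset B by rewrite -e subsetUr.
  have oB : B \in qtop P.
    apply/qtopP => i j; rewrite -e !inE => /orP[iBA ij|iA ij]; last first.
      by rewrite (hA i j) ?orbT.
    case: (boolP (j \in A)) => jA; first by rewrite orbT.
    by move: (h i j); rewrite !inE iBA jA ij orbF; apply.
  by split=> //; apply/opensP; split=> // i j iA _ ij; apply: hA iA ij.
have e : B :\: A :|: A = B.
  apply/setP => x; rewrite !inE; have /subsetP/(_ x) := AB.
  by case: (x \in A) (x \in B) => [] [] // /(_ isT).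
split; last by rewrite e.
apply/opensP; split=> [|i j]; first by apply/subsetP => x; rewrite !inE => /andP[].
rewrite !inE => /andP[_ iB] -> ij; have /qtopP hB := oB; exact: hB iB ij.
Qed.

End OpenSets.

Section DeltaBialgebra.
Variable K : fieldType.

Local Notation "'[' c ']'" := (<< c >> : Hqp K).

Lemma DeltaE' (T : finType) (P : qposet T) : Delta K [qclass P] =
  \sum_(O in qtop P) tens [rclass P (~: O)] [rclass P O].
Proof. exact: DeltaE. Qed.

Lemma DeltaR (T : finType) (P : qposet T) B : Delta K [rclass P B] =
  \sum_(A | opens P B A) tens [rclass P (B :\: A)] [rclass P A].
Proof.
rewrite DeltaE' -(sum_opens P B (fun A => tens [rclass P (B :\: A)] [rclass P A])).
by apply: eq_bigr => O _; rewrite !rclass_restr -val_setC.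
Qed.

Lemma Delta_coassoc x :
  tassoc (tmap (Delta K) idfun (Delta K x)) = tmap idfun (Delta K) (Delta K x).
Proof.
apply: (malg_ext (f := @tassoc K _ _ _ \o (tmap (Delta K) idfun \o Delta K))
                 (g := tmap idfun (Delta K) \o Delta K)) => c /=.
rewrite -[c]qreprK; move: (qrepr c) => P.
rewrite DeltaE' !tmap_sum tassoc_sum.
transitivity (\sum_(O in qtop P) \sum_(C | opens P (~: O) C)
  tens [rclass P (~: O :\: C)] (tens [rclass P C] [rclass P O])).
  apply: eq_bigr => O _; rewrite tmap_tens /= DeltaR tens_suml tassoc_sum.
  by apply: eq_bigr => C _; rewrite tassoc_tens.
rewrite (sum_open_chains P (fun A B C =>
  tens [rclass P A] (tens [rclass P B] [rclass P C]))).
by apply: eq_bigr => O _; rewrite tmap_tens /= DeltaR tens_sumr.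
Qed.

Lemma epsDeltaU (c : qp) : epsDelta K [c] = (c == qp_one)%:R.
Proof. exact: (lextU (M := K^o)). Qed.

Lemma Delta_counitl x : tforml (epsDelta K) (Delta K x) = x.
Proof.
apply: (malg_ext (f := @tforml K _ _ (epsDelta K) \o Delta K)
                 (g := idfun)) => c /=.
rewrite -[c]qreprK; move: (qrepr c) => P.
rewrite DeltaE' tforml_sum (bigD1 setT) ?qtopT //= big1 ?addr0 => [|O].
  by rewrite tforml_tens /= epsDeltaU setCT rclass0 eqxx scale1r rclassT.
move=> /andP[_ OT]; rewrite tforml_tens /= epsDeltaU rclass_eq1.
by rewrite -(inj_eq (@setC_inj _)) setCK setC0 (negPf OT) scale0r.
Qed.

Lemma Delta_counitr x : tformr (epsDelta K) (Delta K x) = x.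
Proof.
apply: (malg_ext (f := @tformr K _ _ (epsDelta K) \o Delta K)
                 (g := idfun)) => c /=.
rewrite -[c]qreprK; move: (qrepr c) => P.
rewrite DeltaE' tformr_sum (bigD1 set0) ?qtop0 //= big1 ?addr0 => [|O].
  by rewrite tformr_tens /= epsDeltaU setC0 rclass0 eqxx scale1r rclassT.
by move=> /andP[_ /negPf O0]; rewrite tformr_tens /= epsDeltaU rclass_eq1 O0 scale0r.
Qed.

Lemma qp_oneE : [qp_one] = 1. Proof. by []. Qed.

Lemma Delta1 : Delta K 1 = 1.
Proof.
rewrite -qp_oneE DeltaE' (big_pred1 set0) => [|O].
  by rewrite rclass0 setC0 rclassT tensUU.
have -> : O = set0 by apply/setP => -[].
by rewrite qtop0 /= eqxx.
Qed.

Lemma qpull_inl (T U : finType) (P : qposet T) (Q : qposet U) :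
  qpull inl (qunion P Q) = P.
Proof. by apply: qposetP => x y; rewrite qpullE qposet_ofE. Qed.

Lemma qpull_inr (T U : finType) (P : qposet T) (Q : qposet U) :
  qpull inr (qunion P Q) = Q.
Proof. by apply: qposetP => x y; rewrite qpullE qposet_ofE. Qed.

Section Union.
Variables (T U : finType) (P : qposet T) (Q : qposet U).

Definition setS (A : {set T}) (B : {set U}) : {set T + U} :=
  inl @: A :|: inr @: B.

Lemma inl_inj : injective (@inl T U). Proof. by move=> x y []. Qed.
Lemma inr_inj : injective (@inr T U). Proof. by move=> x y []. Qed.

Lemma in_setS_l A B x : (inl x \in setS A B) = (x \in A).
Proof.
rewrite in_setU (mem_imset A x inl_inj).
by case: imsetP => [[]//|_]; rewrite orbF.
Qed.

Lemma in_setS_r A B x : (inr x \in setS A B) = (x \in B).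
Proof.
rewrite in_setU (mem_imset B x inr_inj).
by case: imsetP => [[]//|_].
Qed.

Lemma setSC A B : ~: setS A B = setS (~: A) (~: B).
Proof.
by apply/setP => -[x|x]; rewrite inE ?in_setS_l ?in_setS_r inE.
Qed.

Lemma rclass_union A B :
  rclass (qunion P Q) (setS A B) = qp_mul (rclass P A) (rclass Q B).
Proof.
rewrite /setS rclass_setU.
- rewrite -(rclass_pull _ _ inl_inj) -(rclass_pull _ _ inr_inj).
  by rewrite qpull_inl qpull_inr.
- rewrite -setI_eq0; apply/eqP/setP => x; rewrite !inE.
  by apply/negP => /andP[/imsetP[a _ ->] /imsetP[]].
- by move=> _ _ /imsetP[a _ ->] /imsetP[b _ ->]; rewrite !qposet_ofE.
Qed.

Lemma qtop_union A B :
  (setS A B \in qtop (qunion P Q)) = (A \in qtop P) && (B \in qtop Q).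
Proof.
apply/qtopP/andP => [h|[/qtopP hA /qtopP hB]].
  split; apply/qtopP => i j.
    by move: (h (inl i) (inl j)); rewrite !in_setS_l qposet_ofE.
  by move: (h (inr i) (inr j)); rewrite !in_setS_r qposet_ofE.
move=> [i|i] [j|j]; rewrite ?in_setS_l ?in_setS_r qposet_ofE //=.
  exact: hA.
exact: hB.
Qed.

Lemma setS_bij : bijective (fun p : {set T} * {set U} => setS p.1 p.2).
Proof.
exists (fun O : {set T + U} => (inl @^-1: O, inr @^-1: O)).
  move=> [A B] /=; congr pair; apply/setP => x; rewrite inE ?in_setS_l //.
  by rewrite in_setS_r.
by move=> O; apply/setP => -[x|x]; rewrite ?in_setS_l ?in_setS_r inE.
Qed.

End Union.

Lemma DeltaM x y : Delta K (x * y) = Delta K x * Delta K y.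
Proof.
have h (c d : qp) : Delta K (<< c >> * << d >>) = Delta K << c >> * Delta K << d >>.
  rewrite -[c]qreprK -[d]qreprK; move: (qrepr c) (qrepr d) => P Q.
  rewrite mulqE !DeltaE' (reindex _ (onW_bij _ (setS_bij _ _))) /= mulr_suml.
  under [RHS]eq_bigr => O _ do rewrite mulr_sumr.
  rewrite pair_big /=; apply: eq_big => [[A B]|[A B] _] /=.
    by rewrite qtop_union.
  by rewrite tensM setSC !rclass_union !malgUM.
exact: malg_mul_ext h x y.
Qed.

Lemma epsDeltaM x y : epsDelta K (x * y) = epsDelta K x * epsDelta K y.
Proof.
apply: malg_form_ext => c d; rewrite malgUM /= !epsDeltaU -natrM mulnb.
congr (nat_of_bool _)%:R; apply/eqP/andP => [/qp_unit[-> ->] //|[/eqP-> /eqP->]].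
exact: qp_mul1.
Qed.

Lemma epsDelta1 : epsDelta K 1 = 1.
Proof. by rewrite -qp_oneE epsDeltaU eqxx. Qed.

Lemma Delta_bialgebra : is_bialgebra (Delta K) (epsDelta K).
Proof.
split.
- exact: Delta_coassoc.
- exact: Delta_counitl.
- exact: Delta_counitr.
- by split; [exact: Delta1|exact: DeltaM].
- by split; [exact: epsDelta1|exact: epsDeltaM].
Qed.

End DeltaBialgebra.

(** * The coproduct of contractions *)

Section SumType.
Variables (T U : finType).
Implicit Types (E P : qposet (T + U)%type).

Lemma zz_union (E1 : qposet T) (E2 : qposet U) :
  zz (qunion E1 E2) = qunion (zz E1) (zz E2).
Proof.
apply: qposetP => a b; apply/idP/idP.
  apply: zz_equiv_sub.
    by move=> [x|x] [y|y]; rewrite !qposet_ofE //= zz_sym.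
  by move=> [x|x] [y|y]; rewrite !qposet_ofE //=; apply: sub_zz.
case: a b => [x|x] [y|y]; rewrite qposet_ofE //=.
  apply: (zz_min (r := fun x y => zz (qunion E1 E2) (inl x) (inl y))).
  - by move=> z; apply: qrefl.
  - by move=> z t; rewrite zz_sym.
  - by move=> z t u; apply: qtrans.
  - by move=> z t zt; apply: sub_zz; rewrite qposet_ofE.
apply: (zz_min (r := fun x y => zz (qunion E1 E2) (inr x) (inr y))).
- by move=> z; apply: qrefl.
- by move=> z t; rewrite zz_sym.
- by move=> z t u; apply: qtrans.
- by move=> z t zt; apply: sub_zz; rewrite qposet_ofE.
Qed.

Lemma qquo_union (E1 P1 : qposet T) (E2 P2 : qposet U) :
  qquo (qunion P1 P2) (qunion E1 E2) = qunion (qquo P1 E1) (qquo P2 E2).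
Proof.
apply: qposetP => a b; apply/idP/idP.
  apply: qquo_min => -[x|x] [y|y]; rewrite ![qunion _ _ _ _]qposet_ofE //=.
  - exact: qquo_l.
  - exact: qquo_l.
  - exact: qquo_r.
  - exact: qquo_r.
set Q := qquo (qunion _ _) _; have pl : subrel (qquo P1 E1) (qpull inl Q).
  by apply: qquo_min => x y xy; rewrite qpullE; [apply: qquo_l|apply: qquo_r];
    rewrite qposet_ofE.
have pr : subrel (qquo P2 E2) (qpull inr Q).
  by apply: qquo_min => x y xy; rewrite qpullE; [apply: qquo_l|apply: qquo_r];
    rewrite qposet_ofE.
case: a b => [x|x] [y|y]; rewrite [qunion _ _ _ _]qposet_ofE //=.
  by move/pl; rewrite qpullE.
by move/pr; rewrite qpullE.
Qed.

Lemma qres_union (E1 : qposet T) (E2 : qposet U) P :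
  qres P (qunion E1 E2) = qunion (qres (qpull inl P) E1) (qres (qpull inr P) E2).
Proof.
by apply: qposetP => -[x|x] [y|y];
  rewrite !(qresE, qposet_ofE) /= ?andbF // !(qresE, qposet_ofE).
Qed.

Section LeftToRight.
Variables (P : qposet (T + U)%type) (E1 : qposet T) (E2 : qposet U).
Hypothesis Plr : forall x y, ~~ P (inr x) (inl y).

Lemma qquo_rl x y : qquo P (qunion E1 E2) (inr x) (inl y) = false.
Proof.
apply/negP; rewrite [qquo _ _ _ _]qposet_ofE => xy.
pose r (a b : T + U) := match a, b with inr _, inl _ => false | _, _ => true end.
suff: r (inr x) (inl y) by [].
apply: (connect_min (r := r)) xy.
- by case.
- by move=> [?|?] [?|?] [?|?].
- by move=> [a|a] [b|b] //=; rewrite (negPf (Plr _ _)) qposet_ofE.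
Qed.

(** Contraction commutes with restriction to each side when all relations
    between the two sides go from left to right: a path of the quotient with
    both ends on one side never leaves it. *)
Lemma qquo_pull_inl :
  qpull inl (qquo P (qunion E1 E2)) = qquo (qpull inl P) E1.
Proof.
apply: qposetP => x y; rewrite qpullE; apply/idP/idP; last first.
  set Q := qquo P _; rewrite -(qpullE inl Q); apply: qquo_min => a b ab.
    by rewrite qpullE; apply: qquo_l; rewrite qpullE in ab.
  by rewrite qpullE; apply: qquo_r; rewrite qposet_ofE.
rewrite [qquo P _ _ _]qposet_ofE.
pose r (a b : T + U) := match a, b with
  | inl x, inl y => qquo (qpull inl P) E1 x y
  | inr _, inl _ => false | _, _ => true end.
apply: (connect_min (r := r)).
- by case=> // a; apply: qrefl.
- by move=> [a|a] [b|b] [c|c] //=; apply: qtrans.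
- move=> [a|a] [b|b] //=; rewrite ?(negPf (Plr _ _)) [qunion _ _ _ _]qposet_ofE //=.
  by case/orP => ab; [apply: qquo_l; rewrite qpullE|apply: qquo_r].
Qed.

Lemma qquo_pull_inr :
  qpull inr (qquo P (qunion E1 E2)) = qquo (qpull inr P) E2.
Proof.
apply: qposetP => x y; rewrite qpullE; apply/idP/idP; last first.
  set Q := qquo P _; rewrite -(qpullE inr Q); apply: qquo_min => a b ab.
    by rewrite qpullE; apply: qquo_l; rewrite qpullE in ab.
  by rewrite qpullE; apply: qquo_r; rewrite qposet_ofE.
rewrite [qquo P _ _ _]qposet_ofE.
pose r (a b : T + U) := match a, b with
  | inr x, inr y => qquo (qpull inr P) E2 x y
  | inr _, inl _ => false | _, _ => true end.
apply: (connect_min (r := r)).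
- by case=> // a; apply: qrefl.
- by move=> [a|a] [b|b] [c|c] //=; apply: qtrans.
- move=> [a|a] [b|b] //=; rewrite ?(negPf (Plr _ _)) [qunion _ _ _ _]qposet_ofE //=.
  by case/orP => ab; [apply: qquo_l; rewrite qpullE|apply: qquo_r].
Qed.

Lemma triangle_sum : triangle (qunion E1 E2) P =
  triangle E1 (qpull inl P) && triangle E2 (qpull inr P).
Proof.
have ql x y : qquo P (qunion E1 E2) (inl x) (inl y) = qquo (qpull inl P) E1 x y.
  by rewrite -qquo_pull_inl qpullE.
have qr x y : qquo P (qunion E1 E2) (inr x) (inr y) = qquo (qpull inr P) E2 x y.
  by rewrite -qquo_pull_inr qpullE.
apply/triangleP/andP => [[sE cE hE]|[/triangleP[s1 c1 h1] /triangleP[s2 c2 h2]]].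
  rewrite qres_union zz_union in cE; split; apply/triangleP; split => x y.
  - by move: (sE (inl x) (inl y)); rewrite !qposet_ofE.
  - by move: (cE (inl x) (inl y)); rewrite ![qunion _ _ _ _]qposet_ofE.
  - by move: (hE (inl x) (inl y)); rewrite /qsim !ql [qunion _ _ _ _]qposet_ofE.
  - by move: (sE (inr x) (inr y)); rewrite !qposet_ofE.
  - by move: (cE (inr x) (inr y)); rewrite ![qunion _ _ _ _]qposet_ofE.
  - by move: (hE (inr x) (inr y)); rewrite /qsim !qr [qunion _ _ _ _]qposet_ofE.
rewrite qres_union zz_union; split => -[x|x] [y|y];
  rewrite ![qunion _ _ _ _]qposet_ofE //=.
- exact: c1.
- exact: c2.
- by rewrite /qsim !ql; apply: h1.
- by rewrite /qsim qquo_rl andbF.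
- by rewrite /qsim qquo_rl.
- by rewrite /qsim !qr; apply: h2.
Qed.

End LeftToRight.

Definition separated (E : qposet (T + U)%type) : bool :=
  E == qunion (qpull inl E) (qpull inr E).

Lemma separatedP E :
  reflect (forall x y, ~~ E (inl x) (inr y) && ~~ E (inr y) (inl x))
          (separated E).
Proof.
apply: (iffP eqP) => [-> x y|h]; first by rewrite !qposet_ofE.
apply: qposetP => -[x|x] [y|y]; rewrite [RHS]qposet_ofE /= ?qpullE //.
  by have /andP[/negPf] := h x y.
by have /andP[_ /negPf] := h y x.
Qed.

(** A contraction which does not mix the two sides is a pair of contractions,
    one on each side. *)
Lemma sum_separated (M : nmodType) P (F : qposet (T + U)%type -> M) :
  (forall x y, ~~ P (inr x) (inl y)) ->
  \sum_(E | triangle E P && separated E) F E =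
  \sum_(E1 | triangle E1 (qpull inl P))
    \sum_(E2 | triangle E2 (qpull inr P)) F (qunion E1 E2).
Proof.
move=> h; rewrite pair_big /=.
rewrite (reindex_onto (fun p => qunion p.1 p.2)
           (fun E => (qpull inl E, qpull inr E))) /=; last first.
  by move=> E /andP[_ /eqP].
apply: eq_bigl => -[E1 E2] /=.
by rewrite /separated !qpull_inl !qpull_inr !eqxx !andbT triangle_sum.
Qed.

End SumType.

Lemma sum_triangle_exchange (T : finType) (M : nmodType) (P : qposet T)
    (G : qposet T -> qposet T -> M) :
  \sum_(E | triangle E P) \sum_(F | triangle F (qquo P E)) G E F =
  \sum_(F | triangle F P) \sum_(E | triangle E (qres P F)) G E F.
Proof.
rewrite [RHS](exchange_big_dep xpredT) //= !pair_big_dep /=.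
by apply: eq_bigl => -[E F]; apply: triangle_exchange.
Qed.

Section DeltaBialgebra.
Variable K : fieldType.

Local Notation "'[' c ']'" := (<< c >> : Hqp K).

Lemma deltaE' (T : finType) (P : qposet T) : delta K [qclass P] =
  \sum_(E : qposet T | triangle E P) tens [qclass (qquo P E)] [qclass (qres P E)].
Proof. exact: deltaE. Qed.

Lemma epsdeltaU (T : finType) (P : qposet T) :
  epsdelta K [qclass P] = (qdiscrete P)%:R.
Proof. exact: epsdeltaE. Qed.

Lemma delta_coassoc x :
  tassoc (tmap (delta K) idfun (delta K x)) = tmap idfun (delta K) (delta K x).
Proof.
apply: (malg_ext (f := @tassoc K _ _ _ \o (tmap (delta K) idfun \o delta K))
                 (g := tmap idfun (delta K) \o delta K)) => c /=.
rewrite -[c]qreprK; move: (qrepr c) => P.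
rewrite deltaE' !tmap_sum tassoc_sum.
transitivity (\sum_(E | triangle E P) \sum_(F | triangle F (qquo P E))
  tens [qclass (qquo (qquo P E) F)]
    (tens [qclass (qres (qquo P E) F)] [qclass (qres P E)])).
  apply: eq_bigr => E _; rewrite tmap_tens /= deltaE' tens_suml tassoc_sum.
  by apply: eq_bigr => F _; rewrite tassoc_tens.
pose G E F := tens [qclass (qquo P F)]
    (tens [qclass (qquo (qres P F) E)] [qclass (qres (qres P F) E)]).
transitivity (\sum_(F | triangle F P) \sum_(E | triangle E (qres P F)) G E F);
  last first.
  by apply: eq_bigr => F _; rewrite tmap_tens /= deltaE' tens_sumr.
apply: etrans (sum_triangle_exchange P G).
apply: eq_bigr => E tE; apply: eq_bigr => F tF.
have EF := triangle_quo_sub tE tF; have /triangleP[sF _ simF] := tF.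
rewrite (qquo_qquo P EF) in simF.
by rewrite /G (qquo_qquo P EF) (qres_qres P EF) (qres_qquo sF EF simF).
Qed.

Lemma delta_counitl x : tforml (epsdelta K) (delta K x) = x.
Proof.
apply: (malg_ext (f := @tforml K _ _ (epsdelta K) \o delta K)
                 (g := idfun)) => c /=.
rewrite -[c]qreprK; move: (qrepr c) => P.
rewrite deltaE' tforml_sum (bigD1 (zz P)) ?zz_triangle //= big1 ?addr0 => [|E].
  rewrite tforml_tens /= epsdeltaU (qquo_discrete (zz_triangle P)) eqxx scale1r.
  by rewrite qres_zz.
move=> /andP[tE /negPf Ez]; rewrite tforml_tens /= epsdeltaU.
by rewrite (qquo_discrete tE) Ez scale0r.
Qed.

Lemma delta_counitr x : tformr (epsdelta K) (delta K x) = x.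
Proof.
apply: (malg_ext (f := @tformr K _ _ (epsdelta K) \o delta K)
                 (g := idfun)) => c /=.
rewrite -[c]qreprK; move: (qrepr c) => P.
rewrite deltaE' tformr_sum (bigD1 (qcore P)) ?core_triangle //= big1 ?addr0 => [|E].
  rewrite tformr_tens /= epsdeltaU (qres_discrete (core_triangle P)) eqxx scale1r.
  by rewrite qquo_core.
move=> /andP[tE /negPf Ez]; rewrite tformr_tens /= epsdeltaU.
by rewrite (qres_discrete tE) Ez scale0r.
Qed.

Lemma delta_empty (T : finType) (P : qposet T) : #|T| = 0%N ->
  delta K [qclass P] = 1.
Proof.
move=> T0; have c1 (Q : qposet T) : qclass Q = qp_one.
  by apply/eqP; rewrite qclass_eq1 T0.
have eP (Q : qposet T) : Q = P.
  by apply: qposetP => x; have := card0_eq T0 x; rewrite inE.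
rewrite deltaE' (big_pred1 P) => [|E]; first by rewrite !c1 tensUU.
by have := core_triangle P; rewrite (eP E) (eP (qcore P)) /= eqxx.
Qed.

Lemma delta1 : delta K 1 = 1.
Proof. by rewrite -qp_oneE delta_empty ?card_void. Qed.

Lemma deltaM x y : delta K (x * y) = delta K x * delta K y.
Proof.
have h (c d : qp) : delta K (<< c >> * << d >>) = delta K << c >> * delta K << d >>.
  rewrite -[c]qreprK -[d]qreprK; move: (qrepr c) (qrepr d) => P Q.
  rewrite mulqE !deltaE' (eq_bigl (fun E => triangle E (qunion P Q) && separated E)).
    rewrite sum_separated; last by move=> x' y'; rewrite qposet_ofE.
    rewrite qpull_inl qpull_inr mulr_suml; apply: eq_bigr => E1 _.
    rewrite mulr_sumr; apply: eq_bigr => E2 _.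
    rewrite tensM qquo_union qres_union qpull_inl qpull_inr.
    by rewrite !malgUM -!qp_mulE.
  (* the classes of [E] are connected, so they lie on one side *)
  move=> E; case: (boolP (triangle E _)) => // /triangle_zz_sub; rewrite zz_union.
  move=> h; apply/esym/separatedP => a b; apply/andP; split; apply/negP => /h;
  by rewrite qposet_ofE.
exact: malg_mul_ext h x y.
Qed.

Lemma epsdelta1 : epsdelta K 1 = 1.
Proof.
by rewrite -qp_oneE epsdeltaU (_ : qdiscrete _) //; apply/qdiscreteP; case.
Qed.

Lemma epsdeltaM x y : epsdelta K (x * y) = epsdelta K x * epsdelta K y.
Proof.
apply: malg_form_ext => c d; rewrite -[c]qreprK -[d]qreprK.
move: (qrepr c) (qrepr d) => P Q; rewrite mulqE /= !epsdeltaU -natrM mulnb.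
congr (nat_of_bool _)%:R; apply/qdiscreteP/andP => [h|[/qdiscreteP hP /qdiscreteP hQ]].
  split; apply/qdiscreteP => a b.
    by move: (h (inl a) (inl b)); rewrite !qposet_ofE.
  by move: (h (inr a) (inr b)); rewrite !qposet_ofE.
by move=> [a|a] [b|b]; rewrite !qposet_ofE /=.
Qed.

Lemma delta_bialgebra : is_bialgebra (delta K) (epsdelta K).
Proof.
split.
- exact: delta_coassoc.
- exact: delta_counitl.
- exact: delta_counitr.
- by split; [exact: delta1|exact: deltaM].
- by split; [exact: epsdelta1|exact: epsdeltaM].
Qed.

End DeltaBialgebra.

(** * Cointeraction *)

Section OpenContractions.
Variables (T : finType) (P : qposet T) (O : {set T}).
Hypothesis oO : O \in qtop P.

Let s := @glue T O.
Let sbij : bijective s := glue_bij O.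

Lemma qpull_glue_inl E : qpull inl (qpull s E) = qrestr E (~: O).
Proof. by apply: qposetP => x y; rewrite !qpullE. Qed.

Lemma qpull_glue_inr E : qpull inr (qpull s E) = qrestr E O.
Proof. by apply: qposetP => x y; rewrite !qpullE. Qed.

Lemma glue_lr x y : ~~ qpull s P (inr x) (inl y).
Proof.
rewrite qpullE; apply/negP => xy; have /qtopP h := oO.
by have := valP y; rewrite inE (h _ _ (valP x) xy).
Qed.

(** An open set stays open in [P/E] if and only if it is a union of classes of
    [E]. *)
Lemma separated_glue E : triangle E P ->
  separated (qpull s E) = (O \in qtop (qquo P E)).
Proof.
case/triangleP => sE _ _; apply/separatedP/qtopP => [h i j iO|h x y].
  rewrite [qquo P E i j]qposet_ofE => ij; move: iO; apply/implyP.
  apply: (connect_min (r := fun a b => (a \in O) ==> (b \in O))) ij.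
  - by move=> a; apply: implybb.
  - by move=> a b c /implyP h1 /implyP h2; apply/implyP => /h1.
  move=> a b ab; apply/implyP => aO; case/orP: ab => ab.
    by have /qtopP hO := oO; apply: hO ab.
  apply/negPn/negP => bO; rewrite -in_setC in bO.
  by have := h (Sub b bO) (Sub a aO); rewrite !qpullE /= ab andbF.
rewrite !qpullE /= [E (val y) _]sE andbb; apply/negP => xy.
have := valP x; rewrite inE (h _ _ (valP y)) //.
by apply: qquo_r; rewrite sE.
Qed.

(** Glueing [O] to its complement turns [P] into a quasi-poset on a disjoint
    union with relations from the complement to [O] only, where contractions
    compatible with [O] are pairs of contractions. *)
Lemma sum_open_triangles (M : nmodType) (G : qp -> qp -> qp -> M) :
  \sum_(E | triangle E P && (O \in qtop (qquo P E)))
    G (rclass (qquo P E) (~: O)) (rclass (qquo P E) O) (qclass (qres P E)) =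
  \sum_(E1 | triangle E1 (qrestr P (~: O))) \sum_(E2 | triangle E2 (qrestr P O))
    G (qclass (qquo (qrestr P (~: O)) E1)) (qclass (qquo (qrestr P O) E2))
      (qp_mul (qclass (qres (qrestr P (~: O)) E1))
              (qclass (qres (qrestr P O) E2))).
Proof.
pose H E := G (qclass (qpull inl (qquo (qpull s P) E)))
              (qclass (qpull inr (qquo (qpull s P) E)))
              (qclass (qres (qpull s P) E)).
transitivity (\sum_(E | triangle E (qpull s P) && separated E) H E).
  rewrite [RHS](reindex _ (onW_bij _ (qpull_bij sbij))) /=.
  apply: eq_big => [E|E _].
    rewrite (triangle_pull sbij); case: (boolP (triangle E P)) => //= tE.
    by rewrite separated_glue.
  rewrite /H (qquo_pull sbij) qpull_glue_inl qpull_glue_inr; congr G.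
  rewrite -(qclass_pull (qres P E) sbij); congr qclass.
  by apply: qposetP => x y; rewrite !(qpullE, qresE).
rewrite sum_separated; last exact: glue_lr.
rewrite qpull_glue_inl qpull_glue_inr; apply: eq_bigr => E1 _.
apply: eq_bigr => E2 _; rewrite /H qres_union.
rewrite (qquo_pull_inl _ _ glue_lr) (qquo_pull_inr _ _ glue_lr).
by rewrite qpull_glue_inl qpull_glue_inr qp_mulE.
Qed.

End OpenContractions.

Section Cointeraction.
Variable K : fieldType.

Local Notation "'[' c ']'" := (<< c >> : Hqp K).

Lemma qtop_qquo (T : finType) (P E : qposet T) O :
  O \in qtop (qquo P E) -> O \in qtop P.
Proof.
by move=> /qtopP h; apply/qtopP => i j iO ij; apply: h iO _; apply: qquo_l.
Qed.

Lemma delta_Delta x :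
  tmul324 (tmap (delta K) (delta K) (Delta K x)) =
  tmap (Delta K) idfun (delta K x).
Proof.
apply: (malg_ext
  (f := @tmul324 K _ _ \o (tmap (delta K) (delta K) \o Delta K))
  (g := tmap (Delta K) idfun \o delta K)) => c /=.
rewrite -[c]qreprK; move: (qrepr c) => P.
rewrite DeltaE' deltaE' !tmap_sum tmul324_sum.
pose G a b c := tens (tens [a] [b]) [c].
transitivity (\sum_(O in qtop P) \sum_(E | triangle E P && (O \in qtop (qquo P E)))
  G (rclass (qquo P E) (~: O)) (rclass (qquo P E) O) (qclass (qres P E))).
  apply: eq_bigr => O oO; rewrite sum_open_triangles // tmap_tens /= !deltaE'.
  rewrite tens_suml tmul324_sum; apply: eq_bigr => E1 _.
  rewrite tens_sumr tmul324_sum; apply: eq_bigr => E2 _.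
  by rewrite tmul324_tens malgUM.
rewrite (exchange_big_dep (fun E => triangle E P)) /=; last first.
  by move=> O E _ /andP[].
apply: eq_bigr => E tE; rewrite tmap_tens /= DeltaE' tens_suml.
apply: eq_bigl => O; rewrite tE /=.
by apply/andP/idP => [[]//|/[dup]/qtop_qquo].
Qed.

Lemma epsDelta_ext (f : {linear Hqp K -> Hqp K}) :
  (forall c, f [c] = (c == qp_one)%:R%:A) -> forall x, f x = (epsDelta K x)%:A.
Proof.
move=> h x; have fP c a b : f (c *: a + b) = c *: f a + f b := linearP f c a b.
have eP c a b : epsDelta K (c *: a + b) = c * epsDelta K a + epsDelta K b :=
  linearP (epsDelta K) c a b.
have f0 : f 0 = 0 := linear0 f.
have e0 : epsDelta K 0 = 0 := linear0 (epsDelta K).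
elim/malg_ind: x => [|c y x IH]; first by rewrite f0 e0 scale0r.
by rewrite fP eP IH scalerDl -scalerA epsDeltaU h.
Qed.

(** [P/E] is empty only when [P] is. *)
Lemma epsDelta_delta x : tforml (epsDelta K) (delta K x) = (epsDelta K x)%:A.
Proof.
pose f := @tforml K _ _ (epsDelta K) \o delta K.
have fE c : f [c] = (c == qp_one)%:R%:A.
  rewrite -[c]qreprK qclass_eq1; move: (qrepr c) => P; rewrite /f /=.
  case: eqP => [T0|/eqP T0].
    rewrite (delta_empty _ P T0) -tens11 tforml_tens /= -qp_oneE epsDeltaU.
    by rewrite eqxx.
  rewrite deltaE' tforml_sum scale0r big1 // => E _.
  by rewrite tforml_tens /= epsDeltaU qclass_eq1 (negPf T0) scale0r.
exact: (epsDelta_ext fE x).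
Qed.

Lemma Delta_delta_cointeraction :
  cointeraction (Delta K) (epsDelta K) (delta K) (epsdelta K) (delta K).
Proof.
split.
- exact: Delta_bialgebra.
- exact: delta_bialgebra.
- exact: delta_coassoc.
- exact: delta_counitr.
- by rewrite tens11; exact: delta1.
- exact: delta_Delta.
- exact: deltaM.
- exact: epsDelta_delta.
Qed.

End Cointeraction.

(** * The grading and the antipode *)

Section Grading.
Variable K : fieldType.

Local Notation "'[' c ']'" := (<< c >> : Hqp K).

Lemma qp_cl_eq0 c : (qp_cl c == 0%N) = (c == qp_one).
Proof. by rewrite -[c]qreprK qp_clE qclass_eq1 cl_eq0. Qed.

Lemma qp_cl_rclassC (T : finType) (P : qposet T) O : O \in qtop P ->
  (qp_cl (rclass P (~: O)) + qp_cl (rclass P O))%N = cl P.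
Proof.
move=> /qtopP oO; rewrite /rclass !qp_clE (cl_split (B := O)) // => x y.
by case/andP => xy yx; apply/idP/idP => h; apply: oO h _.
Qed.

Lemma qp_clM a b : qp_cl (qp_mul a b) = (qp_cl a + qp_cl b)%N.
Proof.
rewrite -[a]qreprK -[b]qreprK; move: (qrepr a) (qrepr b) => P Q.
rewrite qp_mulE qp_clE -(@qp_cl_rclassC _ _ (setS set0 setT)).
  by rewrite setSC !rclass_union setC0 setCT !rclassT !rclass0 qp_mul1 qp_mul1r.
by rewrite qtop_union qtop0 qtopT.
Qed.

Lemma hqp_degP n x :
  hqp_deg K n x <-> x \in suppin (fun c => qp_cl c == n).
Proof.
split=> [h|/suppin_span]; last first.
  by apply: span_mono => _ [c [/eqP cn ->]]; exists c.
by apply/suppin_span; apply: span_mono h => _ [c [<- ->]]; exists c; rewrite eqxx.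
Qed.

Lemma hqp_degU c n : qp_cl c = n -> hqp_deg K n [c].
Proof. by move=> h; apply: span_gen; exists c. Qed.

Lemma span_mul (A : algType K) (S S' S'' : A -> Prop) x y :
  (forall a b, S a -> S' b -> S'' (a * b)) ->
  Defs.span S x -> Defs.span S' y -> Defs.span S'' (x * y).
Proof.
move=> h hx hy; elim: hx => [|c u v Su _ IH].
  by rewrite mul0r; apply: Defs.span0.
rewrite mulrDl -scalerAl; apply: spanD => //; apply: spanZ.
elim: hy {IH} => [|d w z Sw _ IH]; first by rewrite mulr0; apply: Defs.span0.
rewrite mulrDr -scalerAr; apply: Defs.span_cons => //; exact: h.
Qed.

Lemma hqp_degM m n x y :
  hqp_deg K m x -> hqp_deg K n y -> hqp_deg K (m + n) (x * y).
Proof.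
apply: span_mul => _ _ [c [<- ->]] [d [<- ->]].
by exists (qp_mul c d); rewrite qp_clM malgUM.
Qed.

Lemma hqp_deg1 : hqp_deg K 0 1.
Proof. by apply/hqp_degU/eqP; rewrite qp_cl_eq0. Qed.

Lemma hqp_graded : is_graded_algebra (hqp_deg K).
Proof.
split; [|exact: hqp_deg1|exact: hqp_degM].
apply: (direct_sum_label (l := qp_cl) (p := predT)) => [n x|x].
  exact: hqp_degP.
by split=> // _; apply/suppinP.
Qed.

Lemma hqp_connected x : hqp_deg K 0 x <-> exists c : K, x = c%:A.
Proof.
split=> [/hqp_degP/suppinP h|[c ->]]; last exact/spanZ/hqp_deg1.
exists x@_qp_one; apply/malgP => c; rewrite mcoeffZ mcoeff1.
case: eqP => [->|/eqP c1]; first by rewrite mulr1.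
rewrite mulr0; apply/eqP/negPn/negP => /h.
by rewrite qp_cl_eq0 (negPf c1).
Qed.

Lemma Delta_graded n x : hqp_deg K n x ->
  Defs.span (fun t => exists i j u v,
    [/\ (i + j)%N = n, hqp_deg K i u, hqp_deg K j v & t = tens u v])
    (Delta K x).
Proof.
have DP c a b : Delta K (c *: a + b) = c *: Delta K a + Delta K b :=
  linearP (Delta K) c a b.
have D0 : Delta K 0 = 0 := linear0 (Delta K).
elim=> [|c _ v [d [<- ->]] _ IH]; first by rewrite D0; apply: Defs.span0.
rewrite DP; apply: spanD => //; apply: spanZ.
rewrite -[d]qreprK; move: (qrepr d) => P; rewrite DeltaE'.
apply: span_sum => O _ oO; apply: span_gen.
exists (qp_cl (rclass P (~: O))), (qp_cl (rclass P O)).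
exists [rclass P (~: O)], [rclass P O]; split=> //; [|exact: hqp_degU..].
by rewrite qp_clE qp_cl_rclassC.
Qed.

Lemma epsDelta_deg n x : (0 < n)%N -> hqp_deg K n x -> epsDelta K x = 0.
Proof.
have eP c a b : epsDelta K (c *: a + b) = c * epsDelta K a + epsDelta K b :=
  linearP (epsDelta K) c a b.
move=> n0; elim=> [|c _ v [d [dn ->]] _ IH]; first exact: (linear0 (epsDelta K)).
rewrite eP IH epsDeltaU -qp_cl_eq0 dn.
by rewrite eqn0Ngt n0 mulr0 addr0.
Qed.

End Grading.

Section Antipode.
Variable K : fieldType.
Implicit Types (f g h : qp -> Hqp K) (c d : qp).

Local Notation "'[' c ']'" := (<< c >> : Hqp K).

(** Linear endomorphisms, given by their values on isoclasses, under
    convolution. *)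
Definition conv f g c : Hqp K :=
  tmul (tmap (lext f) (lext g) (Delta K [c])).

Definition conv1 c : Hqp K := (c == qp_one)%:R%:A.

Definition convJ c : Hqp K := [c] - conv1 c.

Lemma convE f g (T : finType) (P : qposet T) :
  conv f g (qclass P) = \sum_(O in qtop P) f (rclass P (~: O)) * g (rclass P O).
Proof.
rewrite /conv DeltaE' tmap_sum tmul_sum; apply: eq_bigr => O _.
by rewrite tmap_tens tmul_tens /= !lextU.
Qed.

Lemma convR f g (T : finType) (P : qposet T) B :
  conv f g (rclass P B) =
  \sum_(A | opens P B A) f (rclass P (B :\: A)) * g (rclass P A).
Proof.
rewrite /conv DeltaR tmap_sum tmul_sum; apply: eq_bigr => O _.
by rewrite tmap_tens tmul_tens /= !lextU.
Qed.

Lemma convA f g h c : conv (conv f g) h c = conv f (conv g h) c.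
Proof.
rewrite -[c]qreprK; move: (qrepr c) => P; rewrite !convE.
under eq_bigr => O _ do rewrite convR mulr_suml.
under [RHS]eq_bigr => O _ do rewrite convR mulr_sumr.
rewrite (sum_open_chains P
  (fun A B C => f (rclass P A) * g (rclass P B) * h (rclass P C))).
by apply: eq_bigr => O _; apply: eq_bigr => A _; rewrite mulrA.
Qed.

Lemma conv_cl f g f' g' c :
  (forall a b, (qp_cl a + qp_cl b)%N = qp_cl c -> f a * g b = f' a * g' b) ->
  conv f g c = conv f' g' c.
Proof.
rewrite -[c]qreprK; move: (qrepr c) => P e; rewrite !convE.
by apply: eq_bigr => O oO; apply: e; rewrite qp_clE qp_cl_rclassC.
Qed.

Lemma conv1l f c : conv conv1 f c = f c.
Proof.
rewrite -[c]qreprK; move: (qrepr c) => P; rewrite convE.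
rewrite (bigD1 setT) ?qtopT //= big1 ?addr0 => [|O /andP[_ OT]].
  by rewrite setCT rclass0 rclassT /conv1 eqxx scale1r mul1r.
rewrite /conv1 rclass_eq1 -(inj_eq (@setC_inj _)) setCK setC0 (negPf OT).
by rewrite scale0r mul0r.
Qed.

Lemma conv1r f c : conv f conv1 c = f c.
Proof.
rewrite -[c]qreprK; move: (qrepr c) => P; rewrite convE.
rewrite (bigD1 set0) ?qtop0 //= big1 ?addr0 => [|O /andP[_ O0]].
  by rewrite setC0 rclass0 rclassT /conv1 eqxx scale1r mulr1.
by rewrite /conv1 rclass_eq1 (negPf O0) scale0r mulr0.
Qed.

Lemma convBl f g h c :
  conv (fun d => f d - g d) h c = conv f h c - conv g h c.
Proof.
rewrite -[c]qreprK; move: (qrepr c) => P; rewrite !convE -sumrB.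
by apply: eq_bigr => O _; rewrite mulrBl.
Qed.

Lemma convBr f g h c :
  conv h (fun d => f d - g d) c = conv h f c - conv h g c.
Proof.
rewrite -[c]qreprK; move: (qrepr c) => P; rewrite !convE -sumrB.
by apply: eq_bigr => O _; rewrite mulrBr.
Qed.

Lemma eq_conv f g f' g' c : f =1 f' -> g =1 g' -> conv f g c = conv f' g' c.
Proof. by move=> e e'; apply: conv_cl => a b _; rewrite e e'. Qed.

Lemma convJ1 c : qp_cl c = 0%N -> convJ c = 0.
Proof.
move/eqP; rewrite qp_cl_eq0 => /eqP->; rewrite /convJ /conv1 eqxx scale1r.
exact: subrr.
Qed.

(** Since [convJ] kills the unit, convolution with it only involves values in
    strictly smaller degree. *)
Lemma conv_Jr f f' c : (forall d, (qp_cl d < qp_cl c)%N -> f d = f' d) ->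
  conv f convJ c = conv f' convJ c.
Proof.
move=> e; apply: conv_cl => a b abc; case: (posnP (qp_cl b)) => b0.
  by rewrite convJ1 // !mulr0.
by rewrite e // -abc -{1}[qp_cl a]addn0 ltn_add2l.
Qed.

Lemma conv_Jl f f' c : (forall d, (qp_cl d < qp_cl c)%N -> f d = f' d) ->
  conv convJ f c = conv convJ f' c.
Proof.
move=> e; apply: conv_cl => a b abc; case: (posnP (qp_cl a)) => a0.
  by rewrite convJ1 // !mul0r.
by rewrite e // -abc -{1}[qp_cl b]add0n ltn_add2r.
Qed.

(** Partial sums of the geometric series of [- convJ], the inverse of the
    identity for convolution. *)
Fixpoint takeuchi n : qp -> Hqp K :=
  if n is m.+1 then fun c => conv1 c - conv (takeuchi m) convJ c else conv1.

Lemma takeuchiS n c :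
  takeuchi n.+1 c = conv1 c - conv (takeuchi n) convJ c.
Proof. by []. Qed.

Arguments takeuchi : simpl never.

(** The recursion holds on the other side as well, so that the resulting
    inverse is two-sided. *)
Lemma takeuchiSl n c :
  takeuchi n.+1 c = conv1 c - conv convJ (takeuchi n) c.
Proof.
elim: n c => [|n IH] c; first by rewrite takeuchiS conv1l conv1r.
rewrite takeuchiS (@eq_conv _ convJ _ convJ c IH (fun=> erefl)).
rewrite convBl conv1l convA.
rewrite (@eq_conv convJ (takeuchi n.+1) convJ _ c (fun=> erefl) (takeuchiS n)).
by rewrite convBr conv1r.
Qed.

(** The series is finite in each degree, because [convJ] vanishes in degree
    zero. *)
Lemma takeuchi_stable n c : (qp_cl c <= n)%N ->
  takeuchi n c = takeuchi (qp_cl c) c.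
Proof.
have step m d : (qp_cl d <= m)%N -> takeuchi m.+1 d = takeuchi m d.
  elim: m d => [|m IH] d dm; rewrite takeuchiS.
    rewrite (@conv_Jr _ (fun d => conv1 d - conv1 d)) => [|d'].
      by rewrite convBl subrr subr0.
    by move=> dd'; have := leq_trans dd' dm; rewrite ltn0.
  rewrite [RHS]takeuchiS (@conv_Jr _ (takeuchi m)) // => d' dd'; apply: IH.
  by rewrite -ltnS (leq_trans dd').
elim: n => [|n IH]; first by rewrite leqn0 => /eqP->.
rewrite leq_eqVlt => /orP[/eqP<- //|cn].
by rewrite step // IH.
Qed.

Definition antipode_basis c : Hqp K := takeuchi (qp_cl c) c.

Definition antipode : Hqp K -> Hqp K := lext antipode_basis.

HB.instance Definition _ := GRing.Linear.on antipode.

Lemma antipode_basisE n c : (qp_cl c <= n)%N ->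
  antipode_basis c = takeuchi n c.
Proof. by move=> cn; rewrite takeuchi_stable. Qed.

(** With the identity written as [conv1 + convJ], this is the recursion of
    [takeuchi] at a stage where the series has become stationary. *)
Lemma antipode_basisl c : conv antipode_basis (fun d => [d]) c = conv1 c.
Proof.
have e d : [d] = conv1 d - (conv1 d - [d]) by rewrite subKr.
have eJ d : conv1 d - [d] = (conv1 d - conv1 d) - convJ d.
  by rewrite /convJ subrr sub0r opprB.
rewrite (@eq_conv _ _ antipode_basis _ c (fun=> erefl) e) convBr conv1r.
rewrite (@eq_conv _ _ antipode_basis _ c (fun=> erefl) eJ) convBr convBr subrr.
rewrite sub0r opprK (@conv_Jr _ (takeuchi (qp_cl c))) => [|d /ltnW]; last first.
  exact: antipode_basisE.
rewrite (@antipode_basisE (qp_cl c).+1) // takeuchiS.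
exact: subrK.
Qed.

Lemma antipode_basisr c : conv (fun d => [d]) antipode_basis c = conv1 c.
Proof.
have e d : [d] = conv1 d - (conv1 d - [d]) by rewrite subKr.
have eJ d : conv1 d - [d] = (conv1 d - conv1 d) - convJ d.
  by rewrite /convJ subrr sub0r opprB.
rewrite (@eq_conv _ antipode_basis _ _ c e (fun=> erefl)) convBl conv1l.
rewrite (@eq_conv _ antipode_basis _ _ c eJ (fun=> erefl)) convBl convBl subrr.
rewrite sub0r opprK (@conv_Jl _ (takeuchi (qp_cl c))) => [|d /ltnW]; last first.
  exact: antipode_basisE.
rewrite (@antipode_basisE (qp_cl c).+1) // takeuchiSl.
exact: subrK.
Qed.

Lemma antipodeP : is_antipode (Delta K) (epsDelta K) antipode.
Proof.
have cE f g c : conv f g c =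
    \sum_(O in qtop (qrepr c)) f (rclass (qrepr c) (~: O)) * g (rclass (qrepr c) O).
  by rewrite -{1}[c]qreprK convE.
move=> x; split.
  pose F := @tmul K qp \o (tmap antipode idfun \o Delta K).
  apply: (epsDelta_ext (f := F)) => c; rewrite -[RHS]/(conv1 c) -antipode_basisl.
  rewrite cE /F /= -{1}[c]qreprK DeltaE' tmap_sum tmul_sum; apply: eq_bigr => O _.
  by rewrite tmap_tens tmul_tens /= /antipode lextU.
pose F := @tmul K qp \o (tmap idfun antipode \o Delta K).
apply: (epsDelta_ext (f := F)) => c; rewrite -[RHS]/(conv1 c) -antipode_basisr.
rewrite cE /F /= -{1}[c]qreprK DeltaE' tmap_sum tmul_sum; apply: eq_bigr => O _.
by rewrite tmap_tens tmul_tens /= /antipode lextU.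
Qed.

Lemma conv1_deg c : hqp_deg K (qp_cl c) (conv1 c).
Proof.
rewrite /conv1; case: eqP => [/eqP|_].
  by rewrite -qp_cl_eq0 => /eqP->; rewrite scale1r; apply: hqp_deg1.
by rewrite scale0r; apply: Defs.span0.
Qed.

Lemma conv_deg f g : (forall c, hqp_deg K (qp_cl c) (f c)) ->
  (forall c, hqp_deg K (qp_cl c) (g c)) ->
  forall c, hqp_deg K (qp_cl c) (conv f g c).
Proof.
move=> hf hg c; rewrite -[c]qreprK; move: (qrepr c) => P; rewrite convE.
apply: span_sum => O _ oO; rewrite qp_clE -(qp_cl_rclassC oO).
exact: hqp_degM.
Qed.

Lemma hqp_degB n x y : hqp_deg K n x -> hqp_deg K n y -> hqp_deg K n (x - y).
Proof.
by move=> hx hy; rewrite -scaleN1r; apply: spanD => //; apply: spanZ.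
Qed.

Lemma takeuchi_deg n c : hqp_deg K (qp_cl c) (takeuchi n c).
Proof.
elim: n c => [|n IH] c; first exact: conv1_deg.
rewrite takeuchiS; apply: hqp_degB; first exact: conv1_deg.
apply: conv_deg => // d; apply: hqp_degB; first exact: hqp_degU.
exact: conv1_deg.
Qed.

Lemma antipode_deg n x : hqp_deg K n x -> hqp_deg K n (antipode x).
Proof.
have aP (c : K) a b : antipode (c *: a + b) = c *: antipode a + antipode b :=
  linearP antipode c a b.
elim=> [|c _ v [d [<- ->]] _ IH].
  by have -> : antipode 0 = 0 := linear0 antipode; apply: Defs.span0.
rewrite aP; apply: spanD => //; apply: spanZ; rewrite /antipode lextU.
exact: takeuchi_deg.
Qed.

Lemma hqp_hopf :
  is_graded_connected_hopf (hqp_deg K) (Delta K) (epsDelta K).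
Proof.
split.
- exact: Delta_bialgebra.
- exact: hqp_graded.
- exact: Delta_graded.
- exact: epsDelta_deg.
- by exists antipode; split; [exact: antipodeP|exact: antipode_deg].
- exact: hqp_connected.
Qed.

End Antipode.

(** * Connected components *)

Definition comp (T : finType) (P : qposet T) x : {set T} := [set y | zz P x y].

Definition comps (T : finType) (P : qposet T) : {set {set T}} :=
  [set comp P x | x : T].

Section Components.
Variable T : finType.
Implicit Types (P : qposet T).

Lemma eq_comp P x y : (comp P x == comp P y) = zz P x y.
Proof.
apply/eqP/idP => [/setP/(_ y)|xy]; first by rewrite !inE qrefl => ->.
apply/setP => z; rewrite !inE; apply/idP/idP; apply: qtrans => //.
by rewrite zz_sym.
Qed.

Lemma comps_empty P : #|T| = 0%N -> comps P = set0.
Proof.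
move=> T0; apply/setP => B; rewrite inE; apply/imsetP => -[x].
by have := card0_eq T0 x; rewrite inE.
Qed.

Lemma comps_connected P : (0 < #|T|)%N -> qconnected P -> comps P = [set setT].
Proof.
move=> /card_gt0P[x _] /qconnectedP c; apply/setP => B; rewrite inE.
have cT y : comp P y = setT by apply/setP => z; rewrite !inE c.
by apply/imsetP/eqP => [[y _ ->]|->]; [|exists x].
Qed.

(** A family of components is seen in the same way from the whole quasi-poset
    and from the restriction to their union. *)
Lemma comps_pull (U : finType) (f : U -> T) P : injective f ->
  (forall x y, P (f x) y || P y (f x) -> y \in [set f u | u : U]) ->
  [set f @: A | A : {set U} in comps (qpull f P)] =
  [set comp P (f x) | x : U].
Proof.
move=> fi cl; rewrite -imset_comp; apply: eq_imset => x /=.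
have fz u v : zz (qpull f P) u v -> zz P (f u) (f v).
  apply: (zz_min (r := fun u v => zz P (f u) (f v))).
  - by move=> w; apply: qrefl.
  - by move=> w w'; apply: zz_sym.
  - by move=> w w' w''; apply: qtrans.
  - by move=> w w'; rewrite qpullE => /sub_zz.
pose r a b := [forall u, (f u == a) ==>
  [exists v, (f v == b) && zz (qpull f P) u v]].
have zr : subrel (zz P) r.
  move=> a b; rewrite qposet_ofE; apply: connect_min => {a b}.
  - move=> a; apply/forallP => u; apply/implyP => fu.
    by apply/existsP; exists u; rewrite fu qrefl.
  - move=> b a c /forallP h /forallP h'; apply/forallP => u; apply/implyP => fu.
    have /implyP/(_ fu)/existsP[v /andP[fv uv]] := h u.
    have /implyP/(_ fv)/existsP[w /andP[fw vw]] := h' v.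
    by apply/existsP; exists w; rewrite fw (qtrans uv vw).
  - move=> a b /= ab; apply/forallP => u; apply/implyP => /eqP fu.
    rewrite -fu in ab; have /imsetP[v _ bv] := cl _ _ ab.
    apply/existsP; exists v; rewrite bv eqxx; rewrite bv in ab.
    by rewrite qposet_ofE; apply: connect1; rewrite /= !qpullE.
apply/setP => y; rewrite inE; apply/imsetP/idP => [[v + ->]|xy].
  by rewrite inE; apply: fz.
have /forallP/(_ x)/implyP := zr _ _ xy; rewrite eqxx => /(_ isT)/existsP[v].
by case/andP => /eqP <- xv; exists v; rewrite // inE.
Qed.

End Components.

Section ComponentProduct.
Variables (R : comPzRingType) (G : qp -> R).

Definition comp_prod (T : finType) (P : qposet T) : R :=
  \prod_(B in comps P) G (rclass P B).

Lemma comp_prod_pull (T U : finType) (f : U -> T) (P : qposet T) :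
  injective f ->
  (forall x y, P (f x) y || P y (f x) -> y \in [set f u | u : U]) ->
  comp_prod (qpull f P) = \prod_(B in [set comp P (f x) | x : U]) G (rclass P B).
Proof.
move=> fi cl; rewrite -(comps_pull fi cl) big_imset /=; last first.
  by move=> A B _ _; apply: imset_inj.
by apply: eq_bigr => A _; rewrite rclass_pull.
Qed.

Lemma comp_prod_bij (T U : finType) (f : U -> T) : bijective f ->
  forall P : qposet T, comp_prod (qpull f P) = comp_prod P.
Proof.
move=> bf P; have [g fK gK] := bf; rewrite comp_prod_pull; last first.
- by move=> x y _; apply/imsetP; exists (g y).
- exact: bij_inj.
apply: eq_bigl => B; apply/imsetP/imsetP => -[x _ ->]; first by exists (f x).
by exists (g x); rewrite ?gK.
Qed.

(** No component meets both sides of a disjoint union. *)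
Lemma comp_prod_union (T U : finType) (P : qposet T) (Q : qposet U) :
  comp_prod (qunion P Q) = comp_prod P * comp_prod Q.
Proof.
have hl : comp_prod P =
    \prod_(B in [set comp (qunion P Q) (inl x) | x : T]) G (rclass (qunion P Q) B).
  rewrite -[P in LHS](qpull_inl P Q) comp_prod_pull //; first exact: inl_inj.
  by move=> x [y|y] h; [apply: imset_f|rewrite !qposet_ofE in h].
have hr : comp_prod Q =
    \prod_(B in [set comp (qunion P Q) (inr x) | x : U]) G (rclass (qunion P Q) B).
  rewrite -[Q in LHS](qpull_inr P Q) comp_prod_pull //; first exact: inr_inj.
  by move=> x [y|y] h; [rewrite !qposet_ofE in h|apply: imset_f].
rewrite hl hr -bigU /=; last first.
  rewrite -setI_eq0; apply/eqP/setP => B; rewrite !inE; apply/negP => /andP[].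
  move=> /imsetP[x _ ->] /imsetP[y _ /eqP]; rewrite eq_comp zz_union.
  by rewrite qposet_ofE.
apply: eq_bigl => B; rewrite !inE /=; apply/imsetP/orP.
  by move=> [[x|x] _ ->]; [left|right]; apply: imset_f.
by case=> /imsetP[x _ ->]; [exists (inl x)|exists (inr x)].
Qed.

(** The extension to all isoclasses, as a morphism of monoids, of the values of
    [G] on the connected ones. *)
Definition compM (c : qp) : R := comp_prod (qrepr c).

Lemma compME (T : finType) (P : qposet T) : compM (qclass P) = comp_prod P.
Proof.
exact: (qisoW (h := fun T => @comp_prod T) comp_prod_bij (qreprK (qclass P))).
Qed.

Lemma compM_mul a b : compM (qp_mul a b) = compM a * compM b.
Proof.
rewrite -[a]qreprK -[b]qreprK qp_mulE; move: (qrepr a) (qrepr b) => P Q.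
by rewrite !compME comp_prod_union.
Qed.

Lemma compM1 : compM qp_one = 1.
Proof. by rewrite compME /comp_prod comps_empty ?card_void // big_set0. Qed.

End ComponentProduct.

Definition conn (c : qp) : bool := (c != qp_one) && qconnected (qrepr c).

Lemma connE (T : finType) (P : qposet T) :
  conn (qclass P) = (#|T| != 0%N) && qconnected P.
Proof.
rewrite /conn qclass_eq1; congr (_ && _).
exact: (qisoW (h := fun T => @qconnected T) qconnected_pull (qreprK (qclass P))).
Qed.

Lemma compM_conn (R : comPzRingType) (G : qp -> R) c :
  conn c -> compM G c = G c.
Proof.
rewrite -[c]qreprK; move: (qrepr c) => P; rewrite connE -lt0n => /andP[T0 cP].
by rewrite compME /comp_prod comps_connected // big_set1 rclassT.
Qed.

(** Every isoclass is a product of connected ones: a quasi-poset with a proper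
    clopen set splits into two strictly smaller parts. *)
Lemma conn_ind (Q : qp -> Prop) : Q qp_one -> (forall c, conn c -> Q c) ->
  (forall a b, Q a -> Q b -> Q (qp_mul a b)) -> forall c, Q c.
Proof.
move=> Q1 Qc QM c; have [n] := ubnP (qp_cl c); elim: n c => // n IH c.
rewrite -[c]qreprK; move: (qrepr c) => P cn.
case: (eqVneq (qclass P) qp_one) => [-> //|P1].
case: (boolP (conn (qclass P))) => [/Qc //|].
rewrite connE -(qclass_eq1 P) P1 /= => /forallPn[O].
rewrite negb_imply => /andP[/andP[/qtopP oO oC] /norP[O0 OT]].
have e : qclass P = qp_mul (rclass P (~: O)) (rclass P O).
  apply: rclass_split => x y xy; apply/idP/idP => [xO|]; first exact: oO xO xy.
  by apply: contraTT; rewrite -!in_setC => xO; have /qtopP h := oC; apply: h xO xy.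
have p1 : (0 < qp_cl (rclass P O))%N by rewrite lt0n qp_cl_eq0 rclass_eq1.
have p2 : (0 < qp_cl (rclass P (~: O)))%N.
  by rewrite lt0n qp_cl_eq0 rclass_eq1 -(inj_eq (@setC_inj _)) setCK setC0.
rewrite e in cn *; rewrite qp_clM ltnS in cn.
apply: QM; apply: IH; apply: leq_trans cn; last by rewrite -[X in (X < _)%N]add0n ltn_add2r.
by rewrite -[X in (X < _)%N]addn0 ltn_add2l.
Qed.

(** * Symmetric algebras *)

Section CommutativeMonomials.
Variable I : choiceType.

Lemma cmonom_ind (Q : {cmonom I} -> Prop) :
  Q mone -> (forall i m, Q m -> Q (mmul (ucm i) m)) -> forall m, Q m.
Proof.
move=> Q1 QM m; have [n] := ubnP (mdeg m); elim: n m => // n IH m mn.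
case: (eqVneq m mone) => [-> //|m1].
have [i im] : exists i, i \in finsupp m.
  have : finsupp m != fset0.
    apply: contra m1 => /eqP m0; apply/cmP => i; rewrite cm1.
    by apply/eqP; rewrite cmE_eq0 m0.
  by case/fset0Pn => i; exists i.
have e : m = mmul (ucm i) (divcm m (ucm i)).
  apply/eqP/cmP => j; rewrite cmM divcmE ucmE.
  case: eqP => [<-|_]; last by rewrite add0n subn0.
  by rewrite subnKC // lt0n cmE_neq0.
rewrite e; apply: QM; apply: IH; move: mn; rewrite {1}e mdegM mdegU.
by rewrite add1n !ltnS.
Qed.

End CommutativeMonomials.

Section SymUniversal.
Variables (K : fieldType) (W : lmodType K) (B : comAlgType K).
Variable l : {linear W -> B}.

(** The universal property of the symmetric algebra: a linear map [l] extends
    to the free commutative algebra on the points of [W], and then factors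
    through the relations expressing linearity. *)
Definition sym_mono (m : {cmonom W}) : B := \prod_(w <- finsupp m) l w ^+ m w.

Lemma sym_monoE (d : {fset W}) (m : {cmonom W}) : (finsupp m `<=` d)%fset ->
  sym_mono m = \prod_(w <- d) l w ^+ m w.
Proof.
move=> le; rewrite /sym_mono (big_fset_incl _ le) // => w _.
by rewrite -cmE_eq0 => /eqP->; rewrite expr0.
Qed.

Lemma sym_monoM m m' : sym_mono (mmul m m') = sym_mono m * sym_mono m'.
Proof.
rewrite (@sym_monoE (finsupp m `|` finsupp m')%fset) ?mdomD //.
rewrite (@sym_monoE _ _ (fsubsetUl (finsupp m) (finsupp m'))).
rewrite (@sym_monoE _ _ (fsubsetUr (finsupp m) (finsupp m'))) -big_split /=.
by apply: eq_bigr => w _; rewrite cmM exprD.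
Qed.

Lemma sym_mono1 : sym_mono mone = 1.
Proof. by rewrite /sym_mono mdom1 big_nil. Qed.

Lemma sym_monoU w : sym_mono (ucm w) = l w.
Proof. by rewrite /sym_mono mdomU big_seq_fset1 cmUU expr1. Qed.

Definition free_map : {malg K[{cmonom W}]} -> B := lext sym_mono.

HB.instance Definition _ := GRing.Linear.on free_map.

Lemma free_mapX w : free_map (symX w) = l w.
Proof. by rewrite /free_map /symX lextU sym_monoU. Qed.

Lemma free_mapM p q : free_map (p * q) = free_map p * free_map q.
Proof.
exact: (lextM sym_monoM).
Qed.

Lemma free_map_rel p : sym_rel p -> free_map p = 0.
Proof.
elim=> [|p' q c u v _ IH]; first exact: (linear0 free_map).
have fP d a b : free_map (d *: a + b) = d *: free_map a + free_map b :=
  linearP free_map d a b.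
have fD a b : free_map (a + b) = free_map a + free_map b := linearD free_map a b.
have fB a b : free_map (a - b) = free_map a - free_map b := linearB free_map a b.
have e : free_map (symX (c *: u + v) - (c *: symX u + symX v)) = 0.
  apply: etrans (fB _ _) _; apply/eqP; rewrite subr_eq0; apply/eqP.
  apply: etrans (free_mapX _) _; rewrite linearP; apply: esym.
  apply: etrans (fP c (symX u) (symX v)) _.
  by congr (_ *: _ + _); apply: free_mapX.
apply: etrans (fD _ _) _; rewrite IH addr0.
by apply: etrans (free_mapM p' _) _; rewrite e mulr0.
Qed.

(** Evaluated on an arbitrary representative; [sym_map_pi] shows that the choice
    is irrelevant. *)
Definition sym_map (x : Sym W) : B := free_map (repr x).

Lemma sym_map_pi p : sym_map (quot_pi (@sym_ideal K W) p) = free_map p.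
Proof.
have fB a b : free_map (a - b) = free_map a - free_map b := linearB free_map a b.
set x := quot_pi _ p; have : repr x - p \in @sym_ideal K W.
  rewrite Quotient.idealrBE; apply/eqP.
  exact: (reprK x).
move=> /asboolP/free_map_rel; rewrite /sym_map => h.
by apply/eqP; rewrite -subr_eq0; apply/eqP; rewrite -[RHS]h; apply/esym/fB.
Qed.

End SymUniversal.

Section Quotient.
Variables (K : fieldType) (R : comAlgType K) (I : idealr R).

Local Notation pi := (quot_pi I).

Lemma quot_pi0 : pi 0 = 0. Proof. exact: (rmorph0 pi). Qed.

Lemma quot_pi1 : pi 1 = 1. Proof. exact: (rmorph1 pi). Qed.

Lemma quot_piM p q : pi (p * q) = pi p * pi q. Proof. exact: (rmorphM pi). Qed.

Lemma quot_piP (c : K) p q : pi (c *: p + q) = c *: pi p + pi q.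
Proof.
rewrite (rmorphD pi); congr (_ + _).
have -> : c *: p = c%:A * p by rewrite -scalerAl mul1r.
exact: (rmorphM pi).
Qed.

Lemma quot_pi_surj (x : quot_alg I) : exists p, x = pi p.
Proof. by exists (repr x); apply/esym/(reprK x). Qed.

End Quotient.

Section SymAlgebra.
Variables (K : fieldType) (W : lmodType K).

Let pi (p : {malg K[{cmonom W}]}) : Sym W := quot_pi (@sym_ideal K W) p.

Lemma sym_piP c p q : pi (c *: p + q) = c *: pi p + pi q.
Proof. exact: quot_piP. Qed.

Lemma sym_pi1 : pi 1 = 1. Proof. exact: quot_pi1. Qed.

Lemma sym_piM p q : pi (p * q) = pi p * pi q. Proof. exact: quot_piM. Qed.

Lemma sym_pi_surj (x : Sym W) : exists p, x = pi p.
Proof. exact: quot_pi_surj. Qed.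

Lemma sym_ind (Q : Sym W -> Prop) : Q 0 -> Q 1 ->
  (forall w x, Q x -> Q (sym_gen w * x)) ->
  (forall c x y, Q x -> Q y -> Q (c *: x + y)) -> forall x, Q x.
Proof.
move=> Q0 Q1 QM QP x; have [p ->] := sym_pi_surj x.
have QU m : Q (pi << m >>).
  elim/cmonom_ind: m => [|w m IH]; first by rewrite -sym_pi1 in Q1.
  have := QM w _ IH; rewrite /sym_gen -/(pi _) -sym_piM.
  by have -> : symX w * << m >> = << mmul (ucm w) m >> by apply/malgUM.
elim/malg_ind: p => [|c m p IH]; first by have -> : pi 0 = 0 := quot_pi0 _.
by rewrite sym_piP; apply: QP.
Qed.

Variables (B : comAlgType K) (l : {linear W -> B}).

Lemma sym_map_linear : linear (sym_map l).
Proof.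
move=> c x y; have [p ->] := sym_pi_surj x; have [q ->] := sym_pi_surj y.
rewrite -sym_piP !sym_map_pi; exact: (linearP (free_map l)).
Qed.

Lemma sym_map_monoid : monoid_morphism (sym_map l).
Proof.
split=> [|x y].
  rewrite -sym_pi1 sym_map_pi.
  by apply: etrans (lextU _ _) (sym_mono1 l).
have [p ->] := sym_pi_surj x; have [q ->] := sym_pi_surj y.
by rewrite -sym_piM !sym_map_pi free_mapM.
Qed.

Lemma sym_map_gen w : sym_map l (sym_gen w) = l w.
Proof. by rewrite sym_map_pi free_mapX. Qed.

HB.instance Definition _ :=
  GRing.isLinear.Build K (Sym W) B *:%R (sym_map l) sym_map_linear.
HB.instance Definition _ :=
  GRing.isMonoidMorphism.Build (Sym W) B (sym_map l) sym_map_monoid.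

Definition sym_lrmap : {lrmorphism Sym W -> B} := sym_map l.

End SymAlgebra.

(** * The algebra of quasi-posets is a symmetric algebra *)

Section FreeAlgebra.
Variable K : fieldType.

Local Notation "'[' c ']'" := (<< c >> : Hqp K).

Definition connspace : submodClosed (Hqp K) := suppin conn.

Local Notation V := (subspace connspace).

Definition conn_incl : {linear V -> Hqp K} := val.

(** The value on isoclasses that are not connected is a placeholder. *)
Definition conn_gen (c : qp) : V := insubd 0 [c].

Lemma conn_genK c : conn c -> val (conn_gen c) = [c].
Proof. by move=> cc; rewrite insubdK // in_suppinU. Qed.

Definition sym_qp : {lrmorphism Sym V -> Hqp K} := sym_lrmap conn_incl.

Lemma sym_qp_gen v : sym_qp (sym_gen v) = val v.
Proof. exact: sym_map_gen. Qed.

Lemma sym_qp1 : sym_qp 1 = 1.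
Proof. exact: (rmorph1 sym_qp). Qed.

Lemma sym_qpM x y : sym_qp (x * y) = sym_qp x * sym_qp y.
Proof. exact: (rmorphM sym_qp). Qed.

Lemma sym_qpP c x y : sym_qp (c *: x + y) = c *: sym_qp x + sym_qp y.
Proof. exact: (linearP sym_qp). Qed.

Lemma sym_qp0 : sym_qp 0 = 0.
Proof. exact: (linear0 sym_qp). Qed.

HB.instance Definition _ := GRing.isLinear.Build K V (Sym V) *:%R
  (@sym_gen K V) (@sym_gen_is_linear K V).

(** The inverse of [sym_qp]: an isoclass goes to the product of the generators
    attached to its connected components. *)
Definition qp_sym_basis (c : qp) : Sym V :=
  compM (fun d => sym_gen (conn_gen d)) c.

Definition qp_sym : Hqp K -> Sym V := lext qp_sym_basis.

HB.instance Definition _ := GRing.Linear.on qp_sym.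

Lemma qp_symU c : qp_sym [c] = qp_sym_basis c.
Proof. exact: lextU. Qed.

Lemma qp_symP c x y : qp_sym (c *: x + y) = c *: qp_sym x + qp_sym y.
Proof. exact: (linearP qp_sym). Qed.

Lemma qp_sym0 : qp_sym 0 = 0.
Proof. exact: (linear0 qp_sym). Qed.

Lemma qp_symM x y : qp_sym (x * y) = qp_sym x * qp_sym y.
Proof. by apply: lextM => a b; apply: compM_mul. Qed.

Lemma qp_sym1 : qp_sym 1 = 1.
Proof. by rewrite -qp_oneE qp_symU; apply: compM1. Qed.

Lemma qp_sym_val v : qp_sym (val v) = sym_gen v.
Proof.
have vE : v = \sum_(c <- msupp (val v)) (val v)@_c *: conn_gen c.
  apply: val_inj; rewrite [LHS]malg_sumE linear_sum big_seq [RHS]big_seq.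
  apply: eq_bigr => c cv; rewrite linearZ /= conn_genK //.
  by have /allP := valP v; apply.
rewrite {2}vE linear_sum {1}[val v]malg_sumE linear_sum big_seq [RHS]big_seq.
apply: eq_bigr => c cv; rewrite !linearZ /= qp_symU; congr (_ *: _).
by apply: compM_conn; have /allP := valP v; apply.
Qed.

Lemma sym_qpK : cancel sym_qp qp_sym.
Proof.
elim/sym_ind => [||w x IH|c x y IH IH'].
- by rewrite sym_qp0 qp_sym0.
- by rewrite sym_qp1 qp_sym1.
- by rewrite sym_qpM qp_symM IH sym_qp_gen qp_sym_val.
- by rewrite sym_qpP qp_symP IH IH'.
Qed.

Lemma qp_sym_basisK c : sym_qp (qp_sym_basis c) = [c].
Proof.
elim/conn_ind: c => [|c cc|a b IHa IHb].
- by rewrite /qp_sym_basis compM1 sym_qp1.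
- by rewrite /qp_sym_basis compM_conn //= sym_qp_gen conn_genK.
- have e : qp_sym_basis (qp_mul a b) = qp_sym_basis a * qp_sym_basis b.
    exact: compM_mul.
  by rewrite e sym_qpM IHa IHb; apply: malgUM.
Qed.

Lemma qp_symK : cancel qp_sym sym_qp.
Proof.
apply: (malg_ext (f := sym_qp \o qp_sym) (g := idfun)) => c.
by rewrite /= qp_symU qp_sym_basisK.
Qed.

Lemma sym_qp_bij : bijective sym_qp.
Proof. exists qp_sym; [exact: sym_qpK|exact: qp_symK]. Qed.

Lemma hpart_connspace n x :
  hpart connspace n x <-> x \in suppin (fun c => conn c && (qp_cl c == n)).
Proof.
split=> [[/suppinP h1 /hqp_degP/suppinP h2]|/suppinP h].
  by apply/suppinP => c xc; rewrite h1 ?h2.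
by split; [|apply/hqp_degP]; apply/suppinP => c /h/andP[].
Qed.

Lemma connspace_direct_sum :
  direct_sum (hpart connspace) (fun x => x \in connspace).
Proof.
by apply: (direct_sum_label (l := qp_cl) (p := conn)) => [n x|x];
  first exact: hpart_connspace.
Qed.

Local Notation deg := (fun d (v : V) => hqp_deg K d (val v)).

Lemma sym_degM m n x y : sym_deg deg m x -> sym_deg deg n y ->
  sym_deg deg (m + n) (x * y).
Proof.
apply: span_mul => _ _ [s [hs <- ->]] [t [ht <- ->]].
exists (s ++ t); rewrite !big_cat; split=> // p.
by rewrite mem_cat => /orP[/hs|/ht].
Qed.

Lemma qp_sym_deg n x : hqp_deg K n x -> sym_deg deg n (qp_sym x).
Proof.
elim=> [|c _ v [d [<- ->]] _ IH]; first by rewrite qp_sym0; apply: Defs.span0.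
rewrite qp_symP; apply: spanD => //; apply: spanZ; rewrite qp_symU {v IH}.
elim/conn_ind: d => [|d cd|a b IHa IHb].
- rewrite /qp_sym_basis compM1; apply: span_gen; exists [::].
  by rewrite !big_nil; split=> //; apply/esym/eqP; rewrite qp_cl_eq0.
- rewrite /qp_sym_basis compM_conn //; apply: span_gen.
  exists [:: (qp_cl d, conn_gen d)]; rewrite !big_seq1; split=> // p.
  by rewrite inE => /eqP->; rewrite conn_genK //; apply: hqp_degU.
- by rewrite /qp_sym_basis compM_mul qp_clM; apply: sym_degM.
Qed.

Lemma sym_qp_degP n y : sym_deg deg n y <-> hqp_deg K n (sym_qp y).
Proof.
split=> [|h]; last by rewrite -[y]sym_qpK; apply: qp_sym_deg.
elim=> [|c _ v [s [hs <- ->]] _ IH]; first by rewrite sym_qp0; apply: Defs.span0.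
rewrite sym_qpP; apply: spanD => //; apply: spanZ; rewrite {v IH}.
elim: s hs => [|p s IH] hs; first by rewrite !big_nil sym_qp1; apply: hqp_deg1.
rewrite !big_cons sym_qpM; apply: hqp_degM.
  by rewrite sym_qp_gen; apply: hs; rewrite inE eqxx.
by apply: IH => q qs; apply: hs; rewrite inE qs orbT.
Qed.

End FreeAlgebra.

(** * Group-like generators and leading terms of contractions *)

Section Label.
Variable K : fieldType.

Local Notation "'[' c ']'" := (<< c >> : Hqp K).

Definition qtotal (T : finType) : qposet T :=
  @qposet_of T (fun _ _ => true) (fun _ => erefl) (fun _ _ _ _ _ => erefl).

Lemma qtotalE (T : finType) (P : qposet T) : (forall x y, P x y) -> P = qtotal T.
Proof. by move=> h; apply: qposetP => x y; rewrite h qposet_ofE. Qed.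

Definition qp1 : choiceType := {c : qp | qp_cl c == 1%N}.

Lemma qp_cl_total (T : finType) (P : qposet T) :
  (forall x y, P x y) -> #|T| != 0%N -> qp_cl (qclass P) == 1%N.
Proof. by move=> h T0; rewrite qp_clE (cl_total h) // lt0n. Qed.

Lemma qp_cl1_conn c : qp_cl c = 1%N -> conn c.
Proof.
move=> c1; have c0 : c != qp_one by rewrite -qp_cl_eq0 c1.
rewrite -[c]qreprK in c1 *; rewrite qp_clE in c1.
rewrite connE -(qclass_eq1 (qrepr c)) qreprK c0; apply/qconnectedP => x y.
exact/sub_zz/cl1_total.
Qed.

Lemma point_cl1 : qp_cl (qclass (qtotal unit)) == 1%N.
Proof. by apply: qp_cl_total; rewrite ?card_unit // => x y; rewrite qposet_ofE. Qed.

(** Outside degree one the value is the class of a point, which the labels below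
    never use on connected isoclasses. *)
Definition to_qp1 (c : qp) : qp1 := insubd (Sub (qclass (qtotal unit)) point_cl1) c.

Lemma to_qp1K c : qp_cl c = 1%N -> val (to_qp1 c) = c.
Proof. by move=> c1; rewrite insubdK //; apply/eqP. Qed.

Definition qp1_gen (i : qp1) : Hqp K := [val i].

Lemma hpart1 x : hpart (connspace K) 1 x <-> hqp_deg K 1 x.
Proof.
split=> [[]//|h]; split=> //; apply/suppinP => c xc; apply: qp_cl1_conn.
by have /hqp_degP/suppinP/(_ c xc)/eqP := h.
Qed.

Lemma qp1_basis : is_basis qp1_gen (hpart (connspace K) 1).
Proof.
split.
- by move=> i; apply/hpart1/hqp_degU/eqP/(valP i).
- move=> x /hpart1/hqp_degP/suppinP h.
  pose s := [seq to_qp1 c | c <- msupp x].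
  have us : uniq s.
    rewrite map_inj_in_uniq ?fset_uniq // => c d.
    rewrite -!mcoeff_neq0 => /h/eqP c1 /h/eqP d1 /(congr1 val).
    by rewrite !to_qp1K.
  exists [fset i in s]%fset, (fun i => x@_(val i)).
  rewrite (perm_big s) /=; last first.
    by apply: uniq_perm => // i; rewrite inE.
  rewrite big_map.
  apply: etrans (malg_sumE x) _.
  apply: eq_big_seq => c.
  rewrite -mcoeff_neq0 => /h/eqP/to_qp1K; rewrite /qp1_gen /= => e.
  by rewrite e.
- by move=> F c; apply: (malgU_free val_inj).
Qed.

(** A total relation has only the trivial contraction, which is why the elements
    of degree one are group-like. *)
Lemma triangle_total (T : finType) (P E : qposet T) :
  (forall x y, P x y) -> triangle E P = (E == P).
Proof.
move=> h; have cP : qcore P = P.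
  by apply: qposetP => x y; rewrite qcoreE /qsim !h.
apply/idP/eqP => [/triangle_core_sub|->]; last by rewrite -{1}cP core_triangle.
by rewrite cP => s; apply: qposetP => x y; rewrite h s.
Qed.

Lemma delta_group_like i :
  delta K (qp1_gen i) = tens (qp1_gen i) (qp1_gen i).
Proof.
case: i => c /=; rewrite /qp1_gen /= -[c]qreprK; move: (qrepr c) => P c1.
rewrite qp_clE in c1; have h := cl1_total (eqP c1).
rewrite deltaE' (big_pred1 P) => [|E]; last exact: triangle_total.
have -> : qquo P P = P.
  by apply: qposetP => x y; rewrite h; apply/qquo_l/h.
have -> // : qres P P = P by apply: qposetP => x y; rewrite qresE h.
Qed.

(** The monomial [\prod_(i <- s) g i] in exponent notation. *)
Definition multiplicity (I : choiceType) (s : seq I) :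
    {fsfun I -> nat with 0%N} :=
  [fsfun i in [fset i in s]%fset => count_mem i s].

Lemma gpow_multiplicity (I : choiceType) (g : I -> Hqp K) (s : seq I) :
  gpow g (multiplicity s) = \prod_(i <- s) g i.
Proof.
have mE i : multiplicity s i = count_mem i s.
  rewrite fsfunE inE; case: ifP => // /negbT/count_memPn->.
  by [].
rewrite -prodr_undup_exp_count /gpow.
rewrite (perm_big (undup s)) /=; last first.
  apply: uniq_perm; rewrite ?fset_uniq ?undup_uniq // => i.
  by rewrite mem_undup mem_finsupp mE -has_pred1 has_count lt0n.
by apply: eq_bigr => i _; rewrite mE.
Qed.

Lemma comp_prod_basis (T : finType) (P : qposet T) :
  [qclass P] = \prod_(B in comps P) [rclass P B].
Proof.
rewrite -[RHS]/(comp_prod (fun d => [d]) P) -compME.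
elim/conn_ind: (qclass P) => [|c cc|a b IHa IHb].
- by rewrite compM1.
- by rewrite compM_conn.
- by rewrite compM_mul -IHa -IHb malgUM.
Qed.

Lemma conn_comp (T : finType) (P : qposet T) B :
  B \in comps P -> conn (rclass P B).
Proof.
case/imsetP => x _ ->; rewrite connE card_sig.
apply/andP; split; first by rewrite -lt0n; apply/card_gt0P; exists x; rewrite !inE qrefl.
have /(qconnected_classesP P (zz_sym P)) : subrel (zz P) (zz (qres P (zz P))).
  by rewrite qres_zz.
by move=> /forallP h; exact: h x.
Qed.

Lemma zz_core (T : finType) (P : qposet T) : zz (qcore P) = qcore P.
Proof.
apply: qposetP => x y; apply/idP/idP; last exact: sub_zz.
by apply: zz_equiv_sub => //; apply: qcore_sym.
Qed.

Lemma cl_core_comp (T : finType) (P : qposet T) B :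
  B \in comps (qcore P) -> qp_cl (rclass (qcore P) B) = 1%N.
Proof.
move=> hB; apply/eqP; apply: qp_cl_total; last first.
  by have := conn_comp hB; rewrite connE => /andP[].
case/imsetP: hB => z _ -> [x xB] [y yB]; rewrite qpullE /=.
rewrite !inE zz_core in xB yB; apply: qtrans yB.
by rewrite qcore_sym.
Qed.

(** The exponents of [~P], seen as the disjoint union of its cells, in the
    generators of degree one. *)
Definition core_label (c : qp) : {fsfun qp1 -> nat with 0%N} :=
  multiplicity [seq to_qp1 (rclass (qcore (qrepr c)) B) |
                 B <- enum (comps (qcore (qrepr c)))].

Lemma core_labelE c :
  gpow qp1_gen (core_label c) = [qclass (qcore (qrepr c))].
Proof.
rewrite gpow_multiplicity big_map big_enum /= comp_prod_basis.
by apply: eq_bigr => B hB; rewrite /qp1_gen to_qp1K // cl_core_comp.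
Qed.

(** The contraction of a connected quasi-poset to a single class. *)
Definition top_label (c : qp) : qp1 :=
  to_qp1 (qclass (qtotal 'I_(tag (repr c)))).

Lemma top_labelE c : c != qp_one ->
  qp1_gen (top_label c) = [qclass (qtotal 'I_(tag (repr c)))].
Proof.
move=> c1; rewrite /qp1_gen to_qp1K //; apply/eqP/qp_cl_total.
  by move=> x y; rewrite qposet_ofE.
by rewrite -(qclass_eq1 (qrepr c)) qreprK.
Qed.

End Label.

Section LeadingTerms.
Variable K : fieldType.

Local Notation "'[' c ']'" := (<< c >> : Hqp K).
Local Notation gen := (sublt (connspace K)).

Lemma sublt_conn n c : conn c -> (0 < qp_cl c < n)%N -> gen n [c].
Proof.
move=> cc cn; apply/subalg_gen/span_gen; exists (qp_cl c); split=> //.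
by apply/hpart_connspace; rewrite in_suppinU cc eqxx.
Qed.

Lemma sublt_prod n (T : finType) (A : {set T}) (F : T -> Hqp K) :
  (forall x, x \in A -> gen n (F x)) -> gen n (\prod_(x in A) F x).
Proof.
move=> h; elim/big_rec: _ => [|x y xA IH]; first exact: subalg1.
by apply: subalgM IH; apply: h.
Qed.

Section Contraction.
Variables (T : finType) (P E : qposet T).
Hypotheses (cP : qconnected P) (T0 : (0 < #|T|)%N) (tE : triangle E P).

Lemma zz_total x y : zz P x y. Proof. exact/qconnectedP. Qed.

(** Contracting more than [~P] merges at least two classes. *)
Lemma sublt_quo : E != qcore P -> gen (cl P) [qclass (qquo P E)].
Proof.
move=> Ec; apply: sublt_conn.
  rewrite connE -lt0n T0; apply/qconnectedP => x y.
  by apply: zz_mono (zz_total x y) => a b; apply: qquo_l.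
rewrite qp_clE lt0n cl_eq0 -lt0n T0 /=.
have sub : subrel (qsim P) (qsim (qquo P E)).
  by move=> x y /andP[xy yx]; rewrite /qsim !qquo_l.
have [x [y /andP[Exy nxy]]] : exists x y, E x y && ~~ qsim P x y.
  case: (boolP [exists x, exists y, E x y && ~~ qsim P x y]).
    by case/existsP => x /existsP[y h]; exists x, y.
  move=> /existsPn h; case/eqP: Ec; apply: qposetP => x y; rewrite qcoreE.
  apply/idP/idP => [Exy|]; last by rewrite -qcoreE; apply: (triangle_core_sub tE).
  by have /existsPn/(_ y) := h x; rewrite Exy /= negbK.
by apply: (cl_mono_lt sub _ nxy); rewrite triangle_sim.
Qed.

(** A component of [P|E] is a class of [E] with the relations of [P]; when it is
    not everything, the classes of [P] outside of it are lost. *)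
Lemma sublt_res : E != zz P -> gen (cl P) [qclass (qres P E)].
Proof.
move=> Ez; rewrite comp_prod_basis; apply: sublt_prod => B hB.
have [sE cE _] := triangleP _ _ tE.
have c0 : (0 < qp_cl (rclass (qres P E) B))%N.
  by rewrite lt0n qp_cl_eq0; have /andP[] := conn_comp hB.
apply: sublt_conn; first exact: conn_comp.
rewrite c0 /=; have simE x y : qsim (qres P E) x y = qsim P x y.
  rewrite /qsim !qresE; apply/andP/andP => [[/andP[-> _] /andP[-> _]]|] //.
  move=> [xy yx]; have Exy : E x y by apply: (triangle_core_sub tE); rewrite qcoreE /qsim xy.
  by rewrite xy yx Exy sE.
have closed x y : qsim (qres P E) x y -> (x \in B) = (y \in B).
  case/imsetP: hB => z _ -> /andP[/sub_zz xy _]; rewrite !inE.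
  apply/idP/idP => h; first exact: qtrans h xy.
  by rewrite zz_sym in xy; apply: qtrans h xy.
rewrite -(eq_cl simE) (cl_split closed) /rclass qp_clE.
rewrite -[X in (X < _)%N]add0n ltn_add2r lt0n cl_eq0 card_sig -lt0n.
apply/card_gt0P; case: (set_0Vmem (~: B)) => [B0|[x xB]]; last by exists x.
case/eqP: Ez; apply: qposetP => x y; rewrite zz_total.
have : x \in B /\ y \in B by rewrite -[B]setCK B0 !inE.
case/imsetP: hB => z _ ->; rewrite !inE => -[zx zy].
have sub := zz_res_sub (P := P) sE.
by apply: qtrans (sub _ _ zy); rewrite sE; apply: sub.
Qed.

End Contraction.

(** The extreme contractions [zz P] and [qcore P] give the two leading terms;
    every other one has a quotient and fibres with fewer classes. *)
Lemma delta_conn c n : conn c -> qp_cl c = n -> (1 < n)%N ->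
  tspan (gen n) (gen n)
    (delta K [c] - tens (qp1_gen K (top_label c)) [c] -
     tens [c] (gpow (qp1_gen K) (core_label c))).
Proof.
move=> cc cn n1; have c1 : c != qp_one by have /andP[] := cc.
rewrite core_labelE top_labelE //.
pose P := qrepr c; have PE : qclass P = c := qreprK c.
have : conn (qclass P) by rewrite PE.
rewrite connE -lt0n => /andP[T0 cP].
rewrite -PE qp_clE in cn.
have zt x y : zz P x y by apply/qconnectedP.
have zc : zz P != qcore P.
  apply/eqP => e; have t x y : P x y by apply: qcore_sub; rewrite -e.
  by move: n1; rewrite -cn (cl_total t).
have -> : delta K [c] =
    tens [qclass (qtotal 'I_(tag (repr c)))] [c] + (tens [c] [qclass (qcore P)] +
    \sum_(E | triangle E P && (E != zz P) && (E != qcore P))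
      tens [qclass (qquo P E)] [qclass (qres P E)]).
  rewrite -[c in LHS]PE deltaE' (bigD1 (zz P)) /=; last exact: zz_triangle.
  have qt : qquo P (zz P) = qtotal _ by apply: qtotalE => x y; apply/qquo_r/zt.
  rewrite qt qres_zz PE; congr (_ + _).
  rewrite (bigD1 (qcore P)) /=; last by rewrite core_triangle eq_sym zc.
  by rewrite qquo_core qres_core PE.
have cancel (M : zmodType) (a b r : M) : a + (b + r) - a - b = r.
  by rewrite [a + _]addrC addrK [b + r]addrC addrK.
rewrite cancel.
apply: span_sum => E _ /andP[/andP[tE Ez] Ec]; apply: span_gen.
exists [qclass (qquo P E)], [qclass (qres P E)]; split=> //; rewrite -cn.
  exact: sublt_quo.
exact: sublt_res.
Qed.

Definition leading_part n (i : qp1) (a : {fsfun qp1 -> nat with 0%N}) :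
    submodClosed (Hqp K) :=
  suppin (fun c => conn c && (qp_cl c == n) &&
                   ((top_label c, core_label c) == (i, a))).

Lemma leading_part_direct_sum n : direct_sum
  (fun (p : qp1 * {fsfun qp1 -> nat with 0%N}) x => x \in leading_part n p.1 p.2)
  (hpart (connspace K) n).
Proof.
apply: (direct_sum_label (l := fun c => (top_label c, core_label c))
                         (p := fun c => conn c && (qp_cl c == n))).
  by case.
exact: hpart_connspace.
Qed.

Lemma delta_leading_part n i a x : (1 < n)%N -> x \in leading_part n i a ->
  tspan (gen n) (gen n)
    (delta K x - tens (qp1_gen K i) x - tens x (gpow (qp1_gen K) a)).
Proof.
move=> n1 /suppin_span; have dP c u v :
  delta K (c *: u + v) = c *: delta K u + delta K v := linearP (delta K) c u v.
have d0 : delta K 0 = 0 := linear0 (delta K).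
elim=> [|k _ v [c [/andP[/andP[cc /eqP cn] /eqP[<- <-]] ->]] _ IH].
  by rewrite d0 tens0r tens0l !subr0; apply: Defs.span0.
have scale_sub (M : lmodType K) (a1 a2 b1 b2 c1 c2 : M) :
    k *: a1 + a2 - (k *: b1 + b2) - (k *: c1 + c2) =
    k *: (a1 - b1 - c1) + (a2 - b2 - c2).
  by rewrite !opprD (addrACA (k *: a1)) (addrACA (k *: a1 - _)) !scalerBr.
rewrite dP tensPr tensPl scale_sub; apply: spanD => //; apply: spanZ.
exact: delta_conn.
Qed.

End LeadingTerms.

Unset Implicit Arguments.

Theorem corollary19 (K : fieldType) (hK : [pchar K] =i pred0) :
  cointeraction (Delta K) (epsDelta K) (delta K) (epsdelta K) (delta K) /\
  exists V : submodClosed (Hqp K),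
    (* 1 *)
    [/\ is_graded_connected_hopf (hqp_deg K) (Delta K) (epsDelta K),
        direct_sum (hpart V) (fun x => x \in V) &
        exists phi : {lrmorphism Sym (subspace V) -> Hqp K},
          [/\ bijective phi,
              forall v : subspace V, phi (sym_gen v) = val v &
              forall n y,
                sym_deg (fun d (v : subspace V) => hqp_deg K d (val v)) n y <->
                hqp_deg K n (phi y)]] /\
    (* 2 *)
    is_bialgebra (delta K) (epsdelta K) /\
    (* 3 *)
    cointeraction (Delta K) (epsDelta K) (delta K) (epsdelta K) (delta K) /\
    (* 4 *)
    (forall x : Hqp K, hpart V 1 x <-> hqp_deg K 1 x) /\
    exists (I : choiceType) (g : I -> Hqp K),
      [/\ is_basis g (hpart V 1),
          forall i, delta K (g i) = tens (g i) (g i) &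
          (* 5 *)
          forall n, (2 <= n)%N ->
            exists W : I -> {fsfun I -> nat with 0%N} -> submodClosed (Hqp K),
              direct_sum
                (fun (p : I * {fsfun I -> nat with 0%N}) x => x \in W p.1 p.2)
                (hpart V n) /\
              forall i a x, x \in W i a ->
                tspan (sublt V n) (sublt V n)
                  (delta K x - tens (g i) x - tens x (gpow g a))].
Proof.
split; first exact: Delta_delta_cointeraction.
exists (connspace K); split; [split|split; [|split; [|split]]].
- exact: hqp_hopf.
- exact: connspace_direct_sum.
- exists (sym_qp K); split.
  + exact: sym_qp_bij.
  + exact: sym_qp_gen.
  + exact: sym_qp_degP.
- exact: delta_bialgebra.
- exact: Delta_delta_cointeraction.
- exact: hpart1.
- exists qp1, (qp1_gen K); split.
  + exact: qp1_basis.
  + exact: delta_group_like.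
  + move=> n n2; exists (leading_part K n); split.
      exact: leading_part_direct_sum.
    by move=> i a x; apply: delta_leading_part.
Qed.
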